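(* Let $G\subseteq Homeo_+(\mathbb R)$ be a group of orientation-preserving homeomorphisms of the line. If there exists a projectively invariant measure for $G$, then the quotient group $G/H_G$ is solvable of length at most two (i.e. metabelian). In particular, if $G\subseteq Homeo_+(\mathbb R)$ is a solvable group containing a freely acting element, then $G/H_G$ is solvable of length at most two (metabelian).
   Context: $Homeo_+(\mathbb R)$ is the group of all orientation-preserving homeomorphisms of $\mathbb R$; $G\subseteq Homeo_+(\mathbb R)$ means that $G$ is a subgroup. An element $g\in G$ is freely acting if it has no fixed point, i.e. $Fix\, g=\{t\in\mathbb R: g(t)=t\}=\emptyset$. Projectively invariant measure: a nonzero Radon measure $\mu$ on $\mathbb R$ (a Borel measure finite on compact sets) such that for every $g\in G$ there is a constant $c_g>0$ with $g_*\mu=c_g\mu$, where $g_*\mu(B)=\mu(g^{-1}(B))$ for Borel sets $B$. Let $G^S=\bigcup_{t\in\mathbb R}St_G(t)$ be the union of the stabilizers $St_G(t)=\{g\in G: g(t)=t\}$ (in general $G^S$ need not be a group). Minimal set of $G$: a (nonempty) closed $G$-invariant subset of $\mathbb R$ containing no proper nonempty closed $G$-invariant subset; if no such set exists, the minimal set is said to be empty. It is a known fact that exactly one of the following holds: (a) minimal sets exist and all of them are discrete; (b) there is a unique minimal set, and it is perfect and nowhere dense; (c) the minimal set is $\mathbb R$; (d) the minimal set is empty. In cases (b) and (c) the unique minimal set is denoted $E(G)$. The normal subgroup $H_G$ of $G$ is defined as follows: (1) if the minimal set is nonempty and not discrete (cases (b), (c)), then $H_G=\{h\in G: h(t)=t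 \text{ for all } t\in E(G)\}$; (2) if the minimal set is nonempty and discrete (case (a)), then $H_G=G^S$ (which in this case is a normal subgroup of $G$); (3) if the minimal set is empty (case (d)), then $H_G=\{e\}$. *)

(* Defs.v *)
From HB Require Import structures.
From mathcomp Require Import all_boot all_order all_algebra generic_quotient.
From mathcomp Require Import all_classical all_reals all_analysis.
Import Order.TTheory GRing.Theory Num.Theory.
Import numFieldNormedType.Exports.

Set Implicit Arguments.
Unset Strict Implicit.
Unset Printing Implicit Defensive.

Local Open Scope classical_set_scope.
Local Open Scope ring_scope.
Local Open Scope group_scope.
Local Open Scope quotient_scope.

Definition subgroup (T : groupType) (S : groupClosed T) : Type :=
  {x : T | x \in S}.

Section SubgroupType.
Variables (T : groupType) (S : groupClosed T).

HB.instance Definition _ := SubChoice.on (subgroup S).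

Fact subgroup_closed : group_closed [pred x | x \in S].
Proof. by split=> [|u v]; rewrite !inE; [exact: gpred1 | exact: gpredF]. Qed.

HB.instance Definition _ :=
  SubChoice_isSubGroup.Build T [pred x | x \in S] (subgroup S) subgroup_closed.

End SubgroupType.

HB.mixin Record isConjClosed (T : groupType) (N : {pred T}) := {
  gpred_conj : forall x y : T, x \in N -> x ^ y \in N
}.

#[short(type="normalClosed")]
HB.structure Definition NormalClosed (T : groupType) :=
  {N of isConjClosed T N & GroupClosed T N}.

Section Quotient.
Variables (T : groupType) (N : normalClosed T).

Definition same_coset (x y : T) : bool := x^-1 * y \in N.

Fact same_coset_refl : reflexive same_coset.
Proof. by move=> x; rewrite /same_coset mulVg gpred1. Qed.

Fact same_coset_sym : symmetric same_coset.
Proof.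
by move=> x y; rewrite /same_coset -[in RHS]gpredV invgM invgK.
Qed.

Fact same_coset_trans : transitive same_coset.
Proof.
move=> y x z xy yz; rewrite /same_coset.
have -> : x^-1 * z = x^-1 * y * (y^-1 * z) by rewrite mulgA mulgK.
exact: gpredM.
Qed.

Canonical same_coset_equiv :=
  EquivRel same_coset same_coset_refl same_coset_sym same_coset_trans.

Definition quotient_group : Type := {eq_quot same_coset}.
HB.instance Definition _ := Choice.on quotient_group.

Definition quotient_map (x : T) : quotient_group := \pi_({eq_quot same_coset}) x.
Definition quotient_repr (a : quotient_group) : T :=
  repr (a : {eq_quot same_coset}).

Definition quotient_mul (a b : quotient_group) : quotient_group :=
  quotient_map (quotient_repr a * quotient_repr b).
Definition quotient_one : quotient_group := quotient_map 1.
Definition quotient_inv (a : quotient_group) : quotient_group :=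
  quotient_map (quotient_repr a)^-1.

Lemma quotient_mapP (x y : T) :
  (quotient_map x = quotient_map y) <-> same_coset x y.
Proof. by split=> [/eqquotP|xy]; [|apply/eqquotP]. Qed.

Fact quotient_reprK : cancel quotient_repr quotient_map.
Proof. by move=> a; exact: reprK. Qed.

Fact quotient_map_surj (P : quotient_group -> Prop) :
  (forall x, P (quotient_map x)) -> forall a, P a.
Proof. by move=> Px a; rewrite -[a]quotient_reprK. Qed.

Fact repr_pi (x : T) : same_coset (quotient_repr (quotient_map x)) x.
Proof. by apply/quotient_mapP; rewrite quotient_reprK. Qed.

Fact same_cosetM x x' y y' :
  same_coset x x' -> same_coset y y' -> same_coset (x * y) (x' * y').
Proof.
rewrite /same_coset => xx' yy'.
have -> : (x * y)^-1 * (x' * y') = (x^-1 * x') ^ y * (y^-1 * y').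
  by rewrite invgM conjgE !mulgA mulgK.
by apply: gpredM => //; exact: gpred_conj.
Qed.

Fact same_cosetV x x' : same_coset x x' -> same_coset x^-1 x'^-1.
Proof.
rewrite same_coset_sym /same_coset => xx'.
have -> : x^-1^-1 * x'^-1 = (x'^-1 * x) ^ x'^-1.
  by rewrite conjgE !invgK !mulgA mulgV mul1g.
exact: gpred_conj.
Qed.

Fact quotient_mul_map x y :
  quotient_mul (quotient_map x) (quotient_map y) = quotient_map (x * y).
Proof. by apply/quotient_mapP/same_cosetM; exact: repr_pi. Qed.

Fact quotient_inv_map x : quotient_inv (quotient_map x) = quotient_map x^-1.
Proof. by apply/quotient_mapP/same_cosetV; exact: repr_pi. Qed.

Fact quotient_mulA : associative quotient_mul.
Proof.
elim/quotient_map_surj=> x; elim/quotient_map_surj=> y.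
by elim/quotient_map_surj=> z; rewrite !quotient_mul_map mulgA.
Qed.

Fact quotient_mul1 : left_id quotient_one quotient_mul.
Proof. by elim/quotient_map_surj=> x; rewrite quotient_mul_map mul1g. Qed.

Fact quotient_mulr1 : right_id quotient_one quotient_mul.
Proof. by elim/quotient_map_surj=> x; rewrite quotient_mul_map mulg1. Qed.

Fact quotient_mulV : left_inverse quotient_one quotient_inv quotient_mul.
Proof.
by elim/quotient_map_surj=> x; rewrite quotient_inv_map quotient_mul_map mulVg.
Qed.

Fact quotient_mulrV : right_inverse quotient_one quotient_inv quotient_mul.
Proof.
by elim/quotient_map_surj=> x; rewrite quotient_inv_map quotient_mul_map mulgV.
Qed.

HB.instance Definition _ := isGroup.Build quotient_group quotient_mulA
  quotient_mul1 quotient_mulr1 quotient_mulV quotient_mulrV.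

End Quotient.

Definition generated_subgroup (T : groupType) (A : set T) : set T :=
  smallest [set B : set T | group_closed (mem B)] A.

Fixpoint derived_series (T : groupType) (n : nat) : set T :=
  if n is m.+1 then
    generated_subgroup [set z | exists x y : T,
      [/\ derived_series m x, derived_series m y & z = [~ x, y]]]
  else [set: T].
Arguments derived_series T n : clear implicits.

Definition solvable_of_length_le (n : nat) (T : groupType) : Prop :=
  derived_series T n = [set 1].

Definition solvable_group (T : groupType) : Prop :=
  exists n, solvable_of_length_le n T.

Definition metabelian (T : groupType) : Prop := solvable_of_length_le 2 T.

Record homeo_plus (R : realType) := HomeoPlus {
  homeo_fun :> R -> R;
  homeo_inv : R -> R;
  homeo_funK : cancel homeo_fun homeo_inv;
  homeo_invK : cancel homeo_inv homeo_fun;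
  homeo_fun_continuous : continuous homeo_fun;
  homeo_inv_continuous : continuous homeo_inv;
  homeo_increasing : {homo homeo_fun : x y / (x < y)%R} }.

Section HomeoGroup.
Variable R : realType.
Implicit Types f g h : homeo_plus R.

HB.instance Definition _ := gen_eqMixin (homeo_plus R).
HB.instance Definition _ := gen_choiceMixin (homeo_plus R).

Lemma homeo_eqP f g : homeo_fun f =1 homeo_fun g -> f = g.
Proof.
move=> /funext fg.
have fg' : homeo_inv f = homeo_inv g.
  by apply/funext => x; rewrite -[in LHS](homeo_invK g x) -fg homeo_funK.
case: f g fg fg' => [f f' a b c d e] [g g' a' b' c' d' e'] /= fg fg'.
by subst g g'; congr HomeoPlus; exact: Prop_irrelevance.
Qed.

Definition homeo_one : homeo_plus R :=
  @HomeoPlus R idfun idfun (fun=> erefl) (fun=> erefl)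
    (fun x => @cvg_id _ (nbhs x)) (fun x => @cvg_id _ (nbhs x)) (fun _ _ => id).

Fact homeo_mul_cont (f g : R -> R) :
  continuous f -> continuous g -> continuous (f \o g).
Proof. by move=> cf cg x; apply: continuous_comp; [exact: cg | exact: cf]. Qed.

Definition homeo_mul f g : homeo_plus R :=
  HomeoPlus (can_comp (homeo_funK f) (homeo_funK g))
    (can_comp (homeo_invK g) (homeo_invK f))
    (homeo_mul_cont (@homeo_fun_continuous _ f) (@homeo_fun_continuous _ g))
    (homeo_mul_cont (@homeo_inv_continuous _ g) (@homeo_inv_continuous _ f))
    (fun x y xy => homeo_increasing f (homeo_increasing g xy)).

Fact homeo_inv_increasing f : {homo homeo_inv f : x y / (x < y)%R}.
Proof.
move=> x y xy; rewrite ltNge; apply/negP; rewrite le_eqVlt => /predU1P[e|].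
  by move: xy; rewrite -(homeo_invK f x) -e homeo_invK ltxx.
by move=> /(homeo_increasing f); rewrite !homeo_invK => /(lt_trans xy); rewrite ltxx.
Qed.

Definition homeo_opp f : homeo_plus R :=
  HomeoPlus (homeo_invK f) (homeo_funK f) (@homeo_inv_continuous _ f)
    (@homeo_fun_continuous _ f) (@homeo_inv_increasing f).

Fact homeo_mulA : associative homeo_mul.
Proof. by move=> f g h; exact: homeo_eqP. Qed.
Fact homeo_mul1 : left_id homeo_one homeo_mul.
Proof. by move=> f; exact: homeo_eqP. Qed.
Fact homeo_mulr1 : right_id homeo_one homeo_mul.
Proof. by move=> f; exact: homeo_eqP. Qed.
Fact homeo_mulV : left_inverse homeo_one homeo_opp homeo_mul.
Proof. by move=> f; apply: homeo_eqP => x /=; rewrite homeo_funK. Qed.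
Fact homeo_mulrV : right_inverse homeo_one homeo_opp homeo_mul.
Proof. by move=> f; apply: homeo_eqP => x /=; rewrite homeo_invK. Qed.

HB.instance Definition _ := isGroup.Build (homeo_plus R)
  homeo_mulA homeo_mul1 homeo_mulr1 homeo_mulV homeo_mulrV.

Lemma homeo_oneE (x : R) : (1 : homeo_plus R) x = x.
Proof. by []. Qed.
Lemma homeo_mulE f g (x : R) : (f * g) x = f (g x).
Proof. by []. Qed.
Lemma homeo_invE f (x : R) : f^-1 x = homeo_inv f x.
Proof. by []. Qed.

End HomeoGroup.

Section Dynamics.
Variables (R : realType) (G : groupClosed (homeo_plus R)).

Definition freely_acting (g : homeo_plus R) : Prop :=
  [set t : R | g t = t] = set0.

Definition projectively_invariant
    (mu : {measure set (measurableTypeR R) -> \bar R}) : Prop :=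
  [/\ exists2 B, measurable B & mu B <> 0%E,
      forall K : set R, compact K -> (mu K < +oo)%E
    & forall g, g \in G -> exists2 c : R, (0 < c)%R &
        forall B, measurable B ->
          pushforward mu (homeo_fun g : measurableTypeR R -> measurableTypeR R) B
          = (c%:E * mu B)%E].

Definition invariant_set (A : set R) : Prop :=
  forall g, g \in G -> homeo_fun g @` A = A.

Definition minimal_set (M : set R) : Prop :=
  [/\ M !=set0, closed M, invariant_set M
    & forall A, A !=set0 -> closed A -> invariant_set A ->
        A `<=` M -> A = M].

Definition discrete_set (A : set R) : Prop := isolated A = A.

(* A non-discrete minimal set is unique, so [xget] does not make an arbitrary
   choice; [set0] is a dummy value when there is none. *)
Definition E_set : set R :=
  xget set0 [set M | minimal_set M /\ ~ discrete_set M].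

Definition act (g : subgroup G) : R -> R := homeo_fun (val g).

Definition stabilizer (t : R) : set (subgroup G) := [set g | act g t = t].

Definition stabilizer_union : set (subgroup G) :=
  \bigcup_(t in [set: R]) stabilizer t.

(* The three cases: the minimal set is unique and not discrete; minimal sets
   exist and all are discrete; there is no minimal set. *)
Definition H_set : set (subgroup G) :=
  if `[< exists M, minimal_set M /\ ~ discrete_set M >] then
    [set h | forall t, E_set t -> act h t = t]
  else if `[< exists M, minimal_set M >] then stabilizer_union
  else [set 1].

Definition H_pred : {pred subgroup G} := fun h => `[< H_set h >].

Lemma actM (g h : subgroup G) x : act (g * h) x = act g (act h x).
Proof. by []. Qed.

Lemma actK (g : subgroup G) : cancel (act g) (act g^-1).
Proof. by move=> x; exact: (homeo_funK (val g)). Qed.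

Lemma act_incr (g : subgroup G) : {homo act g : x y / (x < y)%R}.
Proof. exact: homeo_increasing. Qed.

Lemma invariant_setP A (g : subgroup G) x : invariant_set A -> A x -> A (act g x).
Proof. by move=> /(_ _ (valP g)) {2}<- Ax; exists x. Qed.

Lemma closed_discrete_no_cvg (M : set R) (u : nat -> R) :
  closed M -> discrete_set M -> (forall n, M (u n)) ->
  (forall n, u n != u n.+1) -> ~ cvgn u.
Proof.
move=> cM dM Mu une cu.
have Ml : M (limn u) by exact: (closed_cvg M cM (nearW _ Mu) _ cu).
move: (Ml); rewrite -{1}dM => -[_ [V Vl VM]].
have [N _ NV] := cu _ Vl.
have E n : (N <= n)%N -> u n = limn u.
  by move=> Nn; have : (V `&` M) (u n); [split; [exact: NV|]|rewrite VM].
by have := une N; rewrite !E ?eqxx.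
Qed.

Lemma stabilizer_fixes_discrete (M : set R) (g : subgroup G) t x :
  closed M -> discrete_set M -> invariant_set M ->
  act g t = t -> M x -> act g x = x.
Proof.
move=> cM dM iM.
have key (h : subgroup G) : act h t = t -> M x -> ~ (x < act h x)%R.
  move=> ht Mx xh; pose u : R^nat := fun n => iter n (act h) x.
  have Mu n : M (u n) by elim: n => //= n; exact: invariant_setP.
  have ult n : (u n < u n.+1)%R by elim: n => //= n; exact: act_incr.
  have [xt|tx|xt] := ltgtP x t; last by rewrite xt ht ltxx in xh.
    apply: (closed_discrete_no_cvg cM dM Mu) => [n|]; first by rewrite lt_eqF.
    apply: nondecreasing_is_cvgn.
      by apply/nondecreasing_seqP => n; exact/ltW.
    exists t => _ [n _ <-]; apply/ltW; elim: n => //= n /(act_incr h).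
    by rewrite ht.
  (* [x] lies above the fixed point: iterate the inverse downwards *)
  pose v : R^nat := fun n => iter n (act h^-1) x.
  have Mv n : M (v n) by elim: n => //= n; exact: invariant_setP.
  have vlt n : (v n.+1 < v n)%R.
    elim: n => /= [|n]; last exact: act_incr.
    by rewrite -[ltRHS](actK h); exact: act_incr.
  apply: (closed_discrete_no_cvg cM dM Mv) => [n|]; first by rewrite gt_eqF.
  apply: nonincreasing_is_cvgn.
    by apply/nonincreasing_seqP => n; exact/ltW.
  exists t => _ [n _ <-]; apply/ltW; elim: n => //= n /(act_incr h^-1).
  by rewrite -[X in (act _ X < _)%R]ht actK.
move=> gt Mx; apply/eqP; rewrite eq_le !leNgt; apply/andP; split; apply/negP.
  exact: key.
move=> gx; apply: (key g^-1) => //; first by rewrite -{1}gt actK.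
by rewrite -[ltLHS](actK g); exact: act_incr.
Qed.

Lemma fixator_normal (A : set R) :
  invariant_set A ->
  let F := [set h : subgroup G | forall t, A t -> act h t = t] in
  [/\ F 1, forall g h, F g -> F h -> F (g * h), forall g, F g -> F g^-1
    & forall g h, F g -> F (g ^ h)].
Proof.
move=> iA F; split => //.
- by move=> g h Fg Fh t At; rewrite actM Fh // Fg.
- by move=> g Fg t At; rewrite -{1}(Fg t At) actK.
- move=> g h Fg t At; rewrite conjgE !actM Fg ?actK //.
  exact: invariant_setP.
Qed.

Fact H_set_normal :
  [/\ H_set 1, forall g h, H_set g -> H_set h -> H_set (g * h),
      forall g, H_set g -> H_set g^-1
    & forall g h, H_set g -> H_set (g ^ h)].
Proof.
rewrite /H_set; case: asboolP => [ex|nex].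
  have [M mM] := ex.
  apply: fixator_normal; rewrite /E_set; case: xgetP => [_ -> [[]] //|] /(_ M).
  by case.
case: asboolP => [[M mM]|_]; last first.
  split=> //=.
  - by move=> g h -> ->; rewrite mulg1.
  - by move=> g ->; rewrite invg1.
  - by move=> g h ->; rewrite conj1g.
have dM : discrete_set M by apply: contrapT => dM; apply: nex; exists M.
have [[x Mx] cM iM _] := mM.
suff -> : stabilizer_union = [set h | forall t, M t -> act h t = t].
  exact: fixator_normal.
apply/seteqP; split=> [g [t _ gt] y My|g gM]; last by exists x => //; exact: gM.
exact: (stabilizer_fixes_discrete cM dM iM gt).
Qed.

Fact H_pred1 : 1 \in H_pred.
Proof. by apply/asboolP; have [] := H_set_normal. Qed.

Fact H_predM : mulg_closed H_pred.
Proof.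
by move=> g h /asboolP Hg /asboolP Hh; apply/asboolP; have [_ + _ _] := H_set_normal; apply.
Qed.

Fact H_predV : invg_closed H_pred.
Proof. by move=> g /asboolP Hg; apply/asboolP; have [_ _ + _] := H_set_normal; apply. Qed.

Fact H_predJ : forall x y : subgroup G, x \in H_pred -> x ^ y \in H_pred.
Proof. by move=> g h /asboolP Hg; apply/asboolP; have [_ _ _ +] := H_set_normal; apply. Qed.

(* Packed by hand: the join of the closedness mixins is not inferred. *)
Definition H_group : normalClosed (subgroup G) :=
  HB.pack_for (normalClosed (subgroup G)) H_pred
    (isMul1Closed.Build (subgroup G) H_pred H_pred1)
    (isMulClosed.Build (subgroup G) H_pred H_predM)
    (isInvClosed.Build (subgroup G) H_pred H_predV)
    (isConjClosed.Build (subgroup G) H_pred H_predJ).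

Lemma H_groupP (h : subgroup G) : reflect (H_set h) (h \in H_group).
Proof. exact: asboolP. Qed.

End Dynamics.

Arguments stabilizer {R} G t _.
Arguments stabilizer_union {R} G _.
Arguments H_set {R} G _.
Arguments H_group {R} G.

(* Main.v *)
Require Import Defs.
From HB Require Import structures.
From mathcomp Require Import all_boot all_order all_algebra.
From mathcomp Require Import all_classical all_reals all_analysis.
Import Order.TTheory GRing.Theory Num.Theory.
Import numFieldNormedType.Exports.
From mathcomp Require Import lra ring zify.

Set Implicit Arguments.
Unset Strict Implicit.
Unset Printing Implicit Defensive.

Local Open Scope classical_set_scope.
Local Open Scope ring_scope.

(** Everything comes down to a nondecreasing nonconstant map [Phi] on the line such
    that each [g] in [G] satisfies [Phi (g x) = c * Phi x + d] with [c > 0].  As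
    the group of affine maps is metabelian, the second derived subgroup of [G]
    preserves [Phi], and this forces it to fix each point of increase of [Phi].
    These points form a nonempty closed invariant set [S].  The second derived
    subgroup is then contained in [H_G]: a minimal set that is not discrete lies in
    every nonempty closed invariant set ([nondiscrete_minimal_sub]), a single fixed
    point is enough when the minimal sets are discrete, and the existence of [Phi]
    implies that of a minimal set ([equivariant_minimal_set_exists]).  For a
    projectively invariant measure, [Phi] is its distribution function.

    Let now [G] be solvable with a freely acting element [a].  As every nonempty
    closed invariant set meets a bounded fundamental domain of [a], Zorn's lemma
    gives a minimal set [E].  Let [K] be the last derived subgroup of [G] that acts
    nontrivially on [E]; it acts on [E] as an abelian group.  A normal subgroup that is commutative on [E] and
    whose elements all have fixed points has a common fixed point in [E], thanks to
    [a] ([commuting_common_fixed_point]), hence is trivial on [E] by minimality.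
    Applied to the elements of [K] with a fixed point, this shows that [K] acts
    freely on [E].  If [K = G], the derived subgroup is trivial on [E].  Otherwise
    [K] has no least positive element: such an element would be central on [E] and a
    power of it would be a commutator, which translation along the line excludes
    ([up_central_not_commutator]).  So the translation numbers [tau] embed the
    action of [K] on [E] as a dense subgroup of the reals.  Conjugation by an element
    of [G] multiplies [tau] by a constant, and it follows that
    [Phi x = sup {tau b | b in K, b x0 <= x}], with [x0] in [E], is affinely
    equivariant. *)

(** * Derived series *)

Section DerivedSeries.
Variable T : groupType.
Implicit Types (A B K : set T) (x y z : T).
Local Open Scope group_scope.

Definition is_subgroup K := group_closed (mem K).

Lemma is_subgroupP K :
  is_subgroup K <->
  [/\ K 1, forall x y, K x -> K y -> K (x * y) & forall x, K x -> K x^-1].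
Proof.
split=> [sK|[K1 KM KV]].
  have [/[!inE] K1 _] := sK.
  split=> // [x y Kx Ky|x Kx].
  - by apply/set_mem; apply: group_closedM sK _ _ _ _; rewrite inE.
  - by apply/set_mem; apply: group_closedV sK _ _; rewrite inE.
split=> [|x y]; first by rewrite inE.
by rewrite !inE => Kx Ky; apply: KM => //; exact: KV.
Qed.

Lemma generated_subgroup_group A : is_subgroup (generated_subgroup A).
Proof.
apply/is_subgroupP; split.
- by move=> B [/is_subgroupP[]].
- move=> x y gx gy B [sB AB]; have /is_subgroupP[_ BM _] := sB.
  by apply: BM; [exact: gx | exact: gy].
- move=> x gx B [sB AB]; have /is_subgroupP[_ _ BV] := sB.
  by apply: BV; exact: gx.
Qed.

Lemma generated_subgroup_min A B :
  is_subgroup B -> A `<=` B -> generated_subgroup A `<=` B.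
Proof. by move=> sB AB x; apply. Qed.

Lemma derived_group n : is_subgroup (derived_series T n).
Proof.
case: n => [|n]; last exact: generated_subgroup_group.
exact/is_subgroupP.
Qed.

Lemma derived_comm n x y : derived_series T n x -> derived_series T n y ->
  derived_series T n.+1 [~ x, y].
Proof. by move=> Dx Dy B [_]; apply; exists x, y. Qed.

Lemma derived_min n B : is_subgroup B ->
  (forall x y, derived_series T n x -> derived_series T n y -> B [~ x, y]) ->
  derived_series T n.+1 `<=` B.
Proof.
move=> sB DB; apply: generated_subgroup_min => // _ [x [y [Dx Dy ->]]].
exact: DB.
Qed.

Lemma derived_conj n x y : derived_series T n x -> derived_series T n (x ^ y).
Proof.
elim: n x => // n IH x.
have [D1 DM DV] := (is_subgroupP _).1 (derived_group n.+1).
apply: (@derived_min n [set x | derived_series T n.+1 (x ^ y)]).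
  apply/is_subgroupP; split=> [|u v|u] /=.
  - by rewrite conj1g.
  - by rewrite conjMg; exact: DM.
  - by rewrite conjVg; exact: DV.
by move=> u v Du Dv /=; rewrite conjRg; apply: derived_comm; exact: IH.
Qed.

Lemma derived_succ_sub n : derived_series T n.+1 `<=` derived_series T n.
Proof.
apply: derived_min; first exact: derived_group.
have [_ DM DV] := (is_subgroupP _).1 (derived_group n).
move=> x y Dx Dy; apply: DM; first exact: DV.
exact: derived_conj.
Qed.

End DerivedSeries.

Lemma derived_quotient (T : groupType) (N : normalClosed T) n :
  derived_series (quotient_group N) n `<=`
  @quotient_map T N @` derived_series T n.
Proof.
have qM (x y : T) :
    quotient_map N (x * y)%g = (quotient_map N x * quotient_map N y)%g.
  by rewrite -quotient_mul_map.
have qV (x : T) : quotient_map N (x^-1)%g = ((quotient_map N x)^-1)%g.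
  by rewrite -quotient_inv_map.
elim: n => [|n IH].
  by move=> a _; exists (quotient_repr a) => //; exact: quotient_reprK.
apply: derived_min.
  have [D1 DM DV] := (is_subgroupP _).1 (derived_group T n.+1).
  apply/is_subgroupP; split.
  - by exists 1%g.
  - by move=> _ _ [x Dx <-] [y Dy <-]; exists (x * y)%g; [exact: DM|].
  - by move=> _ [x Dx <-]; exists (x^-1)%g; [exact: DV|].
move=> _ _ /IH[x Dx <-] /IH[y Dy <-]; exists [~ x, y]%g; first exact: derived_comm.
by rewrite !commgEl !conjgE !qM !qV.
Qed.

Lemma metabelian_quotient (T : groupType) (N : normalClosed T) :
  (forall x, derived_series T 2 x -> x \in N) -> metabelian (quotient_group N).
Proof.
move=> DN; apply/seteqP; split=> [a /derived_quotient[x Dx <-]|_ ->]; last first.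
  by have /is_subgroupP[] := derived_group (quotient_group N) 2.
apply/quotient_mapP; rewrite same_coset_sym /same_coset invg1 mul1g.
exact: DN.
Qed.

(** * Groups of increasing homeomorphisms of the line *)

Section IntegerPowers.
Variable T : groupType.
Implicit Types (g h : T) (m n : int).
Local Open Scope group_scope.

Definition zpow g (m : int) : T :=
  match m with Posz n => g ^+ n | Negz n => g ^- n.+1 end.

Lemma zpowS g m : zpow g (m + 1)%R = g * zpow g m.
Proof.
case: m => n.
  have -> : (Posz n + 1)%R = Posz n.+1 by lia.
  by rewrite /= expgS.
case: n => [|n]; first by rewrite /= mulgV.
have -> : (Negz n.+1 + 1)%R = Negz n by rewrite !NegzE; lia.
by rewrite /= [in RHS]expgSr invgM mulVKg.
Qed.

Lemma zpowD g m n : zpow g (m + n)%R = zpow g m * zpow g n.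
Proof.
have natD (k : nat) p : zpow g (k%:Z + p)%R = g ^+ k * zpow g p.
  elim: k p => [|k IH] p; first by rewrite add0r mul1g.
  have -> : (k.+1%:Z + p = (k%:Z + p) + 1)%R by lia.
  by rewrite zpowS IH expgS mulgA.
case: m => k; first exact: natD.
rewrite [RHS]/= -[in RHS](subrK k.+1%:Z n).
have -> : (n - k.+1%:Z + k.+1%:Z = k.+1%:Z + (n - k.+1%:Z))%R by lia.
by rewrite natD mulKg NegzE addrC.
Qed.

Lemma zpowN g m : zpow g (- m)%R = (zpow g m)^-1.
Proof. by apply/esym/mulg1_eq; rewrite -zpowD subrr. Qed.

Lemma zpowSr g m : zpow g (m + 1)%R = zpow g m * g.
Proof. by rewrite zpowD. Qed.

Lemma zpowJ g h m : zpow g m ^ h = zpow (g ^ h) m.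
Proof. by case: m => n /=; rewrite ?conjVg conjXg. Qed.

Lemma zpowM g m (n : nat) : zpow g (m * n%:Z)%R = zpow g m ^+ n.
Proof.
elim: n => [|n IH]; first by rewrite mulr0.
have -> : (m * n.+1%:Z = m + m * n%:Z)%R by lia.
by rewrite zpowD IH expgS.
Qed.

Lemma zpow_closed (K : set T) g m : is_subgroup K -> K g -> K (zpow g m).
Proof.
move=> /is_subgroupP[K1 KM KV] Kg.
have KX (n : nat) : K (g ^+ n) by elim: n => [|n IH] //; rewrite expgS; exact: KM.
by case: m => n; [exact: KX | apply: KV; exact: KX].
Qed.

End IntegerPowers.

Section Action.
Variables (R : realType) (G : groupClosed (homeo_plus R)).
Local Notation T := (subgroup G).
Implicit Types (g h k : T) (x y z : R) (S E K : set R).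

Lemma actVK g : cancel (act g^-1%g) (act g).
Proof. by move=> x; rewrite -actM mulgV. Qed.

Lemma act_lt g x y : (act g x < act g y) = (x < y).
Proof.
apply/idP/idP=> [|/act_incr]; last exact.
by move/(@act_incr _ _ g^-1%g); rewrite !actK.
Qed.

Lemma act_le g x y : (act g x <= act g y) = (x <= y).
Proof. by rewrite !leNgt act_lt. Qed.

Lemma act_inj g : injective (act g).
Proof. exact: can_inj (actK g). Qed.

Lemma le_actV g x y : (act g^-1%g x <= y) = (x <= act g y).
Proof. by rewrite -(act_le g) actVK. Qed.

Lemma lt_actV g x y : (act g^-1%g x < y) = (x < act g y).
Proof. by rewrite -(act_lt g) actVK. Qed.

Lemma actV_le g x y : (x <= act g^-1%g y) = (act g x <= y).
Proof. by rewrite -(act_le g) actVK. Qed.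

Lemma actV_lt g x y : (x < act g^-1%g y) = (act g x < y).
Proof. by rewrite -(act_lt g) actVK. Qed.

Lemma act_commg g h x : act g (act h x) = act h (act g (act [~ g, h]%g x)).
Proof. by rewrite -actM (commgC g h) !actM. Qed.

Lemma act_fixV g x : act g x = x -> act g^-1%g x = x.
Proof. by move=> {1}<-; rewrite actK. Qed.

Lemma act_continuous g : continuous (act g).
Proof. exact: homeo_fun_continuous. Qed.

Lemma closed_fixed_points g : closed [set x | act g x = x].
Proof.
have -> : [set x | act g x = x] = (fun x => act g x - x) @^-1` [set 0].
  apply/seteqP; split=> x /= => [->|/eqP]; first by rewrite subrr.
  by rewrite subr_eq0 => /eqP.
apply: preimage_closed => [x _|]; last exact: closed_eq.
by apply: cvgB; [exact: act_continuous | exact: cvg_id].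
Qed.

Lemma invariantP S : invariant_set G S <-> forall g x, S x -> S (act g x).
Proof.
split=> [iS g x|iS g gG]; first exact: invariant_setP.
pose h : T := exist _ g gG.
apply/seteqP; split=> [_ [x Sx <-]|x Sx]; first exact: (iS h).
by exists (act h^-1%g x); [exact: iS | exact: (actVK h)].
Qed.

Lemma closed_sup S : closed S -> S !=set0 -> has_ubound S -> S (sup S).
Proof. by move=> cS S0 Sub; apply: cS; exact: closure_sup. Qed.

Lemma closure_inf S : S !=set0 -> has_lbound S -> closure S (inf S).
Proof.
move=> S0 Slb V /nbhs_ballP[e e0 eV].
have [y Sy ye] := inf_adherent e0 (conj S0 Slb).
exists y; split=> //; apply: eV; rewrite /ball /= ltr_distlC.
have := ge_inf Slb Sy; lra.
Qed.

Lemma closed_inf S : closed S -> S !=set0 -> has_lbound S -> S (inf S).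
Proof. by move=> cS S0 Slb; apply: cS; exact: closure_inf. Qed.

Lemma sup_fixed S g : S !=set0 -> has_ubound S ->
    (forall x, S x -> S (act g x)) -> (forall x, S x -> S (act g^-1%g x)) ->
  act g (sup S) = sup S.
Proof.
move=> S0 Sub Sg SVg; apply/eqP; rewrite eq_le; apply/andP; split.
  rewrite -actV_le; apply: ge_sup => // x Sx.
  by rewrite actV_le; apply: ub_le_sup => //; exact: Sg.
apply: ge_sup => // x Sx; rewrite -le_actV.
by apply: ub_le_sup => //; exact: SVg.
Qed.

Lemma inf_fixed S g : S !=set0 -> has_lbound S ->
    (forall x, S x -> S (act g x)) -> (forall x, S x -> S (act g^-1%g x)) ->
  act g (inf S) = inf S.
Proof.
move=> S0 Slb Sg SVg; apply/eqP; rewrite eq_le; apply/andP; split.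
  apply: lb_le_inf => // x Sx; rewrite -actV_le.
  by apply: ge_inf => //; exact: SVg.
rewrite -le_actV; apply: lb_le_inf => // x Sx.
by rewrite le_actV; apply: ge_inf => //; exact: Sg.
Qed.

(** A fixed point [p] can be pushed along the line to the nearest point of a
    closed set that is preserved by the homeomorphism. *)
Lemma fixed_point_in_closed S g p : closed S -> S !=set0 ->
    (forall x, S x -> S (act g x)) -> (forall x, S x -> S (act g^-1%g x)) ->
  act g p = p -> exists2 s, S s & act g s = s.
Proof.
move=> cS [s Ss] Sg SVg gp; have gVp := act_fixV gp.
have [sp|ps] := leP s p.
  pose S' := S `&` [set x | x <= p].
  have S'0 : S' !=set0 by exists s.
  have S'ub : has_ubound S' by exists p => x [].
  exists (sup S').
    have [] // : S' (sup S').
    by apply: closed_sup => //; apply: closedI => //; exact: closed_le.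
  apply: sup_fixed => // x [Sx /= xp]; split; rewrite /=.
  - exact: Sg.
  - by rewrite -gp act_le.
  - exact: SVg.
  - by rewrite -gVp act_le.
pose S' := S `&` [set x | p <= x].
have S'0 : S' !=set0 by exists s; split => //; exact: ltW.
have S'lb : has_lbound S' by exists p => x [].
exists (inf S').
  have [] // : S' (inf S').
  by apply: closed_inf => //; apply: closedI => //; exact: closed_ge.
apply: inf_fixed => // x [Sx /= px]; split; rewrite /=.
- exact: Sg.
- by rewrite -gp act_le.
- exact: SVg.
- by rewrite -gVp act_le.
Qed.

Definition up g := forall x, x < act g x.

Lemma up_or_down g : ~ (exists x, act g x = x) -> up g \/ up g^-1%g.
Proof.
move=> nofix.
have key x y : x < act g x -> act g y < y -> False.
  move=> xg gy; apply: nofix; pose f z := act g z - z.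
  have cf : continuous f.
    by move=> z; apply: cvgB; [exact: act_continuous | exact: cvg_id].
  have bridge a b : Num.min (f a) (f b) <= 0 <= Num.max (f a) (f b) -> a <= b ->
      exists x, act g x = x.
    move=> fab ab.
    have [|c _ /eqP] := @IVT R f a b 0 ab _ fab.
      by apply: continuous_subspaceT.
    by rewrite subr_eq0 => /eqP gc; exists c.
  have fx : 0 < f x by rewrite subr_gt0.
  have fy : f y < 0 by rewrite subr_lt0.
  have [xy|yx] := leP x y.
    by apply: bridge xy; rewrite ge_min le_max (ltW fx) (ltW fy) orbT.
  by apply: bridge (ltW yx); rewrite ge_min le_max (ltW fx) (ltW fy) !orbT.
have mv x : act g x <> x by move=> gx; apply: nofix; exists x.
have [x0g|] := boolP (0 < act g 0).
  left=> x; rewrite ltNge le_eqVlt; apply/negP => /predU1P[/mv//|gx].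
  exact: key x0g gx.
rewrite -leNgt le_eqVlt => /predU1P[/mv//|g0].
right=> x; rewrite actV_lt ltNge le_eqVlt; apply/negP => /predU1P[/esym/mv//|gx].
exact: key gx g0.
Qed.

Lemma zpow_lt g x m n : up g -> m < n -> act (zpow g m) x < act (zpow g n) x.
Proof.
move=> ug; have upX (k : nat) y : y < act (g ^+ k.+1)%g y.
  elim: k => [|k IH]; first exact: ug.
  by rewrite expgS actM; apply: lt_trans IH (ug _).
move=> mn; have -> : n = (m + (Posz (absz (n - m)).-1.+1))%R by lia.
by rewrite zpowD actM act_lt; exact: upX.
Qed.

(** A bounded orbit would accumulate at a fixed point. *)
Lemma upX_unbounded g x y : up g -> exists n, y < act (g ^+ n)%g x.
Proof.
move=> ug; apply: contrapT => bnd.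
pose S := range (fun n => act (g ^+ n)%g x).
have S0 : S !=set0 by exists x, 0%N.
have Sub : has_ubound S.
  by exists y => _ [n _ <-]; rewrite leNgt; apply/negP => yn; apply: bnd; exists n.
have := ug (act g^-1%g (sup S)); rewrite actVK => sV.
have [_ [n _ <-]] := sup_gt S0 sV.
rewrite lt_actV -actM -expgS ltNge => /negP; apply.
by apply: ub_le_sup => //; exists n.+1.
Qed.

(** The intervals from [g ^ m x] to [g ^ (m + 1) x] tile the line. *)
Lemma up_floor g x y : up g ->
  exists m, act (zpow g m) x <= y < act (zpow g (m + 1)) x.
Proof.
move=> ug; have [M xM] := upX_unbounded y x ug.
(* Counting from [g ^ (- M) x], which lies below [y], turns the search for an
   integer into the search for a least natural number. *)
pose P n := y < act (zpow g (n%:Z - M%:Z)) x.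
have [n0 Pn0] : exists n, P n.
  have [n yn] := upX_unbounded (act (g ^- M)%g x) y ug.
  by exists n; rewrite /P zpowD zpowN actM.
case: (ex_minnP (ex_intro P n0 Pn0)) => -[|n] Pn minP.
  by move: Pn; rewrite /P sub0r zpowN /= actV_lt ltNge (ltW xM).
exists (n%:Z - M%:Z); apply/andP; split; last first.
  by have <- : (n.+1%:Z - M%:Z = n%:Z - M%:Z + 1)%R by lia.
by rewrite leNgt; apply/negP => /minP; rewrite ltnn.
Qed.

End Action.

(** * Minimal sets *)

Section MinimalSets.
Variables (R : realType) (G : groupClosed (homeo_plus R)).
Local Notation T := (subgroup G).
Implicit Types (g h k : T) (x y z : R) (S E : set R).

Definition orbit x : set R := range (fun g => act g x).

Lemma closure_orbit_invariant x : invariant_set G (closure (orbit x)).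
Proof.
apply/invariantP => g y cy V /(act_continuous (g := g)) /cy[_ [[h _ <-] Vh]].
by exists (act (g * h)%g x); split => //; exists (g * h)%g.
Qed.

Lemma minimal_absorbs E S : minimal_set G E -> closed S -> invariant_set G S ->
  E `&` S !=set0 -> E `<=` S.
Proof.
move=> [_ cE iE minE] cS iS ES; apply/setIidPl; apply: minE => //.
- exact: closedI.
- apply/invariantP => g x [Ex Sx]; split; exact: invariant_setP.
Qed.

Lemma minimal_orbit_dense E x y V : minimal_set G E -> E x -> E y -> nbhs y V ->
  exists g, V (act g x).
Proof.
move=> mE Ex Ey Vy.
have /(_ _ Ey _ Vy)[_ [[g _ <-] Vg]] : E `<=` closure (orbit x).
  apply: (minimal_absorbs mE); first exact: closed_closure.
    exact: closure_orbit_invariant.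
  by exists x; split => //; apply: subset_closure; exists 1%g.
by exists g.
Qed.

(** By density of orbits, a single isolated point makes all points isolated. *)
Lemma minimal_isolated_discrete E e : minimal_set G E -> isolated E e ->
  discrete_set E.
Proof.
move=> mE [/set_mem Ee [V Ve VE]]; apply/seteqP; split; first exact: isolatedS.
move=> y Ey; have [g Vg] := minimal_orbit_dense mE Ey Ee Ve.
have [_ _ iE _] := mE.
have at_e z : E z -> V (act g z) -> act g z = e.
  move=> Ez Vz; have : (V `&` E) (act g z) by split=> //; exact: invariant_setP.
  by rewrite VE.
have ge := at_e y Ey Vg.
split; first exact/mem_set.
exists (act g @^-1` V); first by apply: act_continuous; rewrite ge.
apply/seteqP; split=> [z [Vz Ez]|_ -> //].
by apply: (@act_inj _ _ g); rewrite ge; exact: at_e.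
Qed.

Lemma global_fixed_point_minimal x : (forall g, act g x = x) ->
  minimal_set G [set x].
Proof.
move=> fx; split.
- by exists x.
- exact: closed_eq.
- by apply/invariantP => g _ ->; exact: fx.
- move=> A [y Ay] _ _ Ax; apply/seteqP; split=> // _ ->.
  by have <- := Ax _ Ay.
Qed.

Lemma discrete_set1 x : discrete_set [set x].
Proof.
apply/seteqP; split; first exact: isolatedS.
move=> _ ->; split; first by rewrite inE.
by exists setT; [exact: filterT | rewrite setTI].
Qed.

(** If [E] missed [S], then [E] would have a point [y] above a point of [S]:
    otherwise [sup E] is a global fixed point and [E] is a singleton.  Below [y],
    let [a] be the last point of [S] and [e] the first point of [E] after [a].  No
    element of [G] can move [e] upwards inside the gap of [S] containing it, since
    it would fix [a] and its inverse would push [e] further down.  As the orbit of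
    [e] is dense in [E], it follows that [e] is isolated in [E]. *)
Lemma nondiscrete_minimal_sub E S : minimal_set G E -> ~ discrete_set E ->
  closed S -> S !=set0 -> invariant_set G S -> E `<=` S.
Proof.
move=> mE ndE cS [s Ss] iS; have [E0 cE iE minE] := mE.
apply: (minimal_absorbs mE) => //; apply: contrapT => disj.
have {}disj x : E x -> S x -> False by move=> Ex Sx; apply: disj; exists x.
have [y Ey sy] : exists2 y, E y & s < y.
  apply: contrapT => Es; have Eub : has_ubound E.
    by exists s => y Ey; rewrite leNgt; apply/negP => sy; apply: Es; exists y.
  have Esup : [set sup E] = E.
    have [|sup0 csup isup _] := @global_fixed_point_minimal (sup E).
      by move=> g; apply: sup_fixed => // x; exact: invariant_setP.
    by apply: minE => // _ ->; exact: closed_sup.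
  by apply: ndE; rewrite -Esup; exact: discrete_set1.
pose S' := S `&` [set x | x <= y].
have cS' : closed S' by apply: closedI => //; exact: closed_le.
have S'0 : S' !=set0 by exists s; split => //; exact: ltW.
have S'ub : has_ubound S' by exists y => x [].
set a := sup S'; have [Sa /= ay] : S' a by exact: closed_sup.
pose E' := E `&` [set x | a <= x].
have cE' : closed E' by apply: closedI => //; exact: closed_ge.
have E'0 : E' !=set0 by exists y.
have E'lb : has_lbound E' by exists a => x [].
set e := inf E'; have [Ee /= ae] : E' e by exact: closed_inf.
have e_min z : E z -> a <= z -> e <= z by move=> Ez az; exact: ge_inf.
have ey : e <= y by exact: e_min.
have a_lt_e : a < e.
  rewrite lt_neqAle ae andbT; apply/eqP => ae'.
  by apply: (disj a); rewrite // ae'.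
have S_gap z : S z -> z <= y -> z <= a by move=> Sz zy; exact: ub_le_sup.
have [d d0 dS] : exists2 d, 0 < d & forall z, S z -> e < z -> e + d <= z.
  have /nbhs_ballP[d /= d0 dS] : nbhs e (~` S).
    apply: open_nbhs_nbhs; split; first exact: closed_openC.
    by move=> Se; exact: disj Ee Se.
  exists d => // z Sz ez; rewrite leNgt; apply/negP => zd.
  by apply: (dS z) => //; rewrite /ball /= ltr_distlC; lra.
have S_le_a z : S z -> z < e + d -> z <= a.
  move=> Sz zd; have [ze|ez] := leP z e.
    by apply: S_gap => //; exact: le_trans ze ey.
  by have := dS _ Sz ez; lra.
apply: ndE; apply: (minimal_isolated_discrete mE (e := e)).
split; first exact/mem_set.
exists `]a, (e + d)[%classic.
  apply: open_nbhs_nbhs; split; first exact: interval_open.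
  by rewrite /= in_itv /= a_lt_e ltrDl.
apply/seteqP; split=> [z [/=]|_ ->]; last first.
  by split => //=; rewrite in_itv /= a_lt_e ltrDl.
rewrite in_itv /= => /andP[az zd] Ez.
have := e_min _ Ez (ltW az); rewrite le_eqVlt => /predU1P[//|ez].
have [g /=] : exists g, `]e, (e + d)[%classic (act g e).
  apply: (minimal_orbit_dense mE Ee Ez); apply: open_nbhs_nbhs.
  by split; [exact: interval_open | rewrite /= in_itv /= ez].
rewrite in_itv /= => /andP[ege ged].
have ga : act g a = a.
  apply/eqP; rewrite eq_le; apply/andP; split.
    apply: S_le_a; first exact: invariant_setP.
    by apply: lt_trans ged; rewrite act_lt.
  rewrite -le_actV; apply: S_le_a; first exact: invariant_setP.
  by rewrite lt_actV; apply: lt_trans (lt_trans a_lt_e ege) _; rewrite act_lt ltrDl.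
have := e_min (act g^-1%g e) (invariant_setP _ iE Ee).
rewrite actV_le ga actV_le => /(_ ae); rewrite leNgt ege; exact.
Qed.

(** In the discrete case any fixed point of [h] will do; otherwise [E_set G] is
    contained in [S]. *)
Lemma fixed_closed_set_metabelian S :
    closed S -> S !=set0 -> invariant_set G S -> (exists E, minimal_set G E) ->
    (forall h : T, derived_series T 2 h -> forall x, S x -> act h x = x) ->
  metabelian (quotient_group (H_group G)).
Proof.
move=> cS S0 iS minE DS; apply: metabelian_quotient => h Dh; apply/H_groupP.
have hS := DS _ Dh; rewrite /H_set; case: asboolP => [[M mM]|_].
  move=> t; rewrite /E_set; case: xgetP => [E _ [mE ndE] Et|/(_ M)//].
  exact/hS/(nondiscrete_minimal_sub mE ndE).
by case: asboolP => // _; have [s Ss] := S0; exists s => //; exact: hS.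
Qed.

Section FreeElement.
Variable a : T.
Hypothesis up_a : up a.

(** The orbit under [a] of any point visits each fundamental domain of [a]. *)
Lemma invariant_meets_domain S x : invariant_set G S -> S !=set0 ->
  exists y, [/\ S y, x <= y & y <= act a x].
Proof.
move=> iS [s Ss]; have [m /andP[sm ms]] := up_floor s (act a x) up_a.
exists (act (zpow a m) s); split => //; first exact: invariant_setP.
by move: ms; rewrite addrC zpowD actM act_lt => /ltW.
Qed.

(** Zorn's lemma on open invariant sets: the complements of the members of a
    chain have least points above [0] in a fundamental domain, and the supremum
    of these points lies in all the complements. *)
Lemma minimal_set_exists : exists E, minimal_set G E.
Proof.
pose P (U : set R) := [/\ open U, ~` U !=set0 & invariant_set G (~` U)].
have [|U [[oU U0 iU] maxU]] := @Zorn_bigcup R P.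
  move=> F FP chF; have [F0|nF0] := pselect (F !=set0); last first.
    have -> : F = set0 by apply/seteqP; split=> // U FU; apply: nF0; exists U.
    rewrite bigcup_set0 /P setC0; split; first exact: open0.
      by exists 0.
    by apply/invariantP.
  pose S U := ~` U `&` [set x : R | 0 <= x].
  pose m U := inf (S U).
  have SP U : F U -> [/\ S U (m U), 0 <= m U, m U <= act a 0
      & forall y, ~ U y -> 0 <= y -> m U <= y].
    move=> FU; have [oU U0 iU] := FP _ FU.
    have [y [Uy y0 ya]] := invariant_meets_domain 0 iU U0.
    have Slb : has_lbound (S U) by exists 0 => z [].
    have minU z : ~ U z -> 0 <= z -> m U <= z by move=> Uz z0; apply: ge_inf.
    have Sm : S U (m U).
      apply: closed_inf => //; last by exists y.
      by apply: closedI; [exact: open_closedC | exact: closed_ge].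
    split=> //; first by have [] := Sm.
    by apply: le_trans ya; exact: minU.
  pose M := sup (m @` F).
  have mF0 : m @` F !=set0 by have [U FU] := F0; exists (m U), U.
  have mub : has_ubound (m @` F).
    by exists (act a 0) => _ [U FU <-]; have [] := SP _ FU.
  have mM U : F U -> m U <= M by move=> FU; apply: ub_le_sup => //; exists U.
  have MU U : F U -> ~ U M.
    move=> FU UM; have [oU _ _] := FP _ FU.
    have /nbhs_ballP[e /= e0 eU] := open_nbhs_nbhs (conj oU UM).
    have inU z : M - e < z -> z <= M -> U z.
      by move=> z1 z2; apply: eU; rewrite /ball /= ltr_distlC; lra.
    have [_ [V FV <-] Vm] : exists2 z, (m @` F) z & M - e < z.
      by apply: sup_gt => //; rewrite ltrBlDr ltrDl.
    have [[Vm' _] _ _ _] := SP _ FV; have [[Um' _] _ _ _] := SP _ FU.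
    have [UV|VU] := chF _ _ FU FV.
      by apply/Vm'/UV/inU => //; exact: mM.
    apply: (Um'); apply: inU; last exact: mM.
    have [_ m0U _ _] := SP _ FU; have [_ _ _ minV] := SP _ FV.
    by apply: lt_le_trans Vm (minV _ _ m0U) => /VU /Um'.
  split.
  - by apply: bigcup_open => U /FP[].
  - by exists M => -[U FU UM]; exact: MU FU UM.
  - apply/invariantP => g x Ux [U FU Ugx].
    have [_ _ /invariantP iU] := FP _ FU.
    apply: Ux; exists U => //; apply: contrapT => nUx; exact: (iU g x nUx).
exists (~` U); split => //; first exact: open_closedC.
move=> A A0 cA iA AU; apply: contrapT => neq.
apply: (maxU (~` A)); last by split; rewrite ?setCK //; exact: closed_openC.
split; first by rewrite -[X in X `<=` _]setCK; exact: subsetC.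
by move=> AU'; apply: neq; apply/seteqP; split => //; rewrite -[A]setCK; exact: subsetC.
Qed.

End FreeElement.

End MinimalSets.

(** * Monotone maps equivariant up to affine transformations *)

Section AffineEquivariant.
Variables (R : realType) (G : groupClosed (homeo_plus R)).
Local Notation T := (subgroup G).
Implicit Types (g h k : T) (x y z : R) (S E : set R).

(** A possibly discontinuous semiconjugacy from the action of [G] to an action by
    affine maps. *)
Definition affine_equivariant (Phi : R -> R) : Prop :=
  [/\ {homo Phi : x y / x <= y}, exists x y, Phi x < Phi y
    & forall g, exists c d, 0 < c /\ forall x, Phi (act g x) = c * Phi x + d].

Definition increase_points (Phi : R -> R) : set R :=
  [set x | forall u v, u < x -> x < v -> Phi u < Phi v].

Variable Phi : R -> R.
Hypothesis PhiP : affine_equivariant Phi.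

Let Phi_mono : {homo Phi : x y / x <= y}. Proof. by have [] := PhiP. Qed.

Let Phi_lt x y : Phi x < Phi y -> x < y.
Proof. by rewrite !ltNge; apply: contraNN => /Phi_mono. Qed.

Local Notation S := (increase_points Phi).

Lemma increase_points_closed : closed S.
Proof.
move=> x clx u v ux xv.
have [z [Sz]] : S `&` `]u, v[%classic !=set0.
  apply: clx; apply: open_nbhs_nbhs; split; first exact: interval_open.
  by rewrite /= in_itv /= ux.
by rewrite /= in_itv /= => /andP[uz zv]; exact: Sz.
Qed.

(** Past the supremum of the points where [Phi] is at most [Phi p], the map has
    left the value [Phi p]. *)
Lemma increase_points_nonempty : S !=set0.
Proof.
have [_ [p [q pq]] _] := PhiP; pose A := [set x | Phi x <= Phi p].
have A0 : A !=set0 by exists p; rewrite /A /=.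
have Aub : has_ubound A.
  by exists q => x Ax; apply/ltW/Phi_lt; exact: le_lt_trans Ax pq.
exists (sup A) => u v us sv; apply: (@le_lt_trans _ _ (Phi p)).
  by have [x Ax ux] := sup_gt A0 us; apply: le_trans Ax; exact/Phi_mono/ltW.
rewrite ltNge; apply/negP => Av; have := ub_le_sup Aub Av.
by rewrite leNgt sv.
Qed.

Lemma increase_points_invariant : invariant_set G S.
Proof.
apply/invariantP => g x Sx u v ux xv.
have [_ _ /(_ g)[c [d [c0 Phig]]]] := PhiP.
rewrite -[u](actVK g) -[v](actVK g) !Phig ltrD2r ltr_pM2l //.
by apply: Sx; rewrite ?lt_actV ?actV_lt.
Qed.

(** If [g] moved [x] upwards, [Phi] would take the same value at the points
    [g^-1 x] and [g x], which lie on both sides of [x]. *)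
Lemma Phi_invariant_fixes g : (forall x, Phi (act g x) = Phi x) ->
  forall x, S x -> act g x = x.
Proof.
move=> Phig.
have key h x : (forall x, Phi (act h x) = Phi x) -> S x -> ~ x < act h x.
  move=> Phih Sx xh; have := Sx (act h^-1%g x) (act h x).
  rewrite lt_actV => /(_ xh xh); rewrite Phih -[X in _ < Phi X](actVK h) Phih ltxx.
  exact.
have PhiV x : Phi (act g^-1%g x) = Phi x by rewrite -[in RHS](actVK g x) Phig.
move=> x Sx; apply/eqP; rewrite eq_le !leNgt; apply/andP; split; apply/negP.
  exact: key.
by rewrite -actV_lt; exact: key.
Qed.

Definition translating : set T :=
  [set g | exists d, forall x, Phi (act g x) = Phi x + d].

Lemma translating_group : is_subgroup translating.
Proof.
apply/is_subgroupP; split.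
- by exists 0 => x; rewrite addr0.
- by move=> g h [d gd] [e he]; exists (e + d) => x; rewrite actM gd he addrA.
- by move=> g [d gd]; exists (- d) => x; rewrite -[in RHS](actVK g x) gd addrK.
Qed.

(** The linear parts of affine maps commute, so that a commutator acts on the
    values of [Phi] by a translation. *)
Lemma commutator_translating g h : translating [~ g, h]%g.
Proof.
have [_ _ aff] := PhiP.
have [c [d [c0 gE]]] := aff g; have [c' [d' [c'0 hE]]] := aff h.
exists ((c * d' + d - (c' * d + d')) / (c' * c)) => x.
have := congr1 Phi (act_commg g h x).
rewrite !gE !hE gE => E.
have cc0 : c' * c != 0 by rewrite mulf_neq0 ?gt_eqF.
apply: (mulfI cc0); rewrite mulrDr mulrCA divff // mulr1.
lra.
Qed.

Lemma derived2_Phi g : derived_series T 2 g -> forall x, Phi (act g x) = Phi x.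
Proof.
apply: (@derived_min _ 1 [set g | forall x, Phi (act g x) = Phi x]).
  apply/is_subgroupP; split=> //= [h k Eh Ek x|h Eh x].
  - by rewrite actM Eh.
  - by rewrite -[in RHS](actVK h x) Eh.
have D1 : derived_series T 1 `<=` translating.
  apply: derived_min; first exact: translating_group.
  by move=> *; exact: commutator_translating.
move=> h k /D1[d hE] /D1[e kE] x.
have := congr1 Phi (act_commg h k x).
by rewrite !(hE, kE) -addrA (addrC e) addrA => /addIr/addIr.
Qed.

Lemma derived2_fixes g : derived_series T 2 g -> forall x, S x -> act g x = x.
Proof. by move=> /derived2_Phi; exact: Phi_invariant_fixes. Qed.

(** A freely acting element gives a minimal set.  If there is none, translating
    elements fix the increase points, so [G] acts on them through a commutative
    group; an element that scales [Phi] has one or two fixed increase points, and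
    these are then fixed by [G]. *)
Lemma equivariant_minimal_set_exists : exists E, minimal_set G E.
Proof.
have [[a fr]|nofree] := pselect (exists a : T, ~ exists x, act a x = x).
  by have [] := up_or_down fr; exact: minimal_set_exists.
have fixpt g : exists x, act g x = x.
  by apply: contrapT => ng; apply: nofree; exists g.
have transl_fix g x : translating g -> S x -> act g x = x.
  move=> [d gE]; apply: Phi_invariant_fixes => y.
  have [p gp] := fixpt g; have := gE p; rewrite gp -[LHS]addr0 => /addrI d0.
  by rewrite gE -d0 addr0.
have [[g [x [Sx gx]]]|triv] := pselect (exists g x, S x /\ act g x <> x);
  last first.
  have [s Ss] := increase_points_nonempty; exists [set s].
  apply: global_fixed_point_minimal => g; apply: contrapT => gs.
  by apply: triv; exists g, s.
have Sinv h y : S y -> S (act h y) := invariant_setP h increase_points_invariant.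
have [p gp] := fixpt g.
have [q Sq gq] : exists2 s, S s & act g s = s.
  apply: (fixed_point_in_closed _ _ _ _ gp).
  - exact: increase_points_closed.
  - exact: increase_points_nonempty.
  - exact: Sinv.
  - exact: Sinv.
have [_ _ /(_ g)[c [d [c0 gE]]]] := PhiP.
have c1 : 1 - c != 0.
  apply/eqP => /subr0_eq c1; apply: gx; apply: transl_fix Sx.
  by exists d => y; rewrite gE -c1 mul1r.
have Phifix y : act g y = y -> Phi y = d / (1 - c).
  move=> gy; apply: (mulIf c1); rewrite divfK //.
  have := gE y; rewrite gy => E; lra.
have no3 x1 x2 x3 :
    act g x1 = x1 -> S x2 -> act g x3 = x3 -> x1 < x2 -> x2 < x3 -> False.
  move=> g1 S2 g3 lt12 lt23; have := S2 _ _ lt12 lt23.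
  by rewrite (Phifix x1) // (Phifix x3) // ltxx.
(* The commutator of [g] and [h] fixes [y], so [g] and [h] commute at [y]. *)
have gfix h y : S y -> act g y = y -> act g (act h y) = act h y.
  move=> Sy gy; rewrite act_commg.
  by rewrite (transl_fix [~ g, h]%g) ?gy //; exact: commutator_translating.
exists [set q]; apply: global_fixed_point_minimal => h.
have ghq := gfix h q Sq gq; have ghhq := gfix h _ (Sinv h _ Sq) ghq.
case: (ltgtP (act h q) q) => // hq.
  by case: (no3 _ _ _ ghhq (Sinv h _ Sq) gq _ hq); rewrite act_lt.
by case: (no3 _ _ _ gq (Sinv h _ Sq) ghhq hq); rewrite act_lt.
Qed.

Theorem equivariant_metabelian : metabelian (quotient_group (H_group G)).
Proof.
apply: (fixed_closed_set_metabelian (S := S)).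
- exact: increase_points_closed.
- exact: increase_points_nonempty.
- exact: increase_points_invariant.
- exact: equivariant_minimal_set_exists.
- by move=> h /derived2_fixes.
Qed.

End AffineEquivariant.

(** * From invariant measures to equivariant maps *)

Section DistributionFunction.
Variables (R : realType) (G : groupClosed (homeo_plus R)).
Variable mu : {measure set (measurableTypeR R) -> \bar R}.
Hypothesis muP : projectively_invariant G mu.
Local Notation T := (subgroup G).

Let m (a b : R) : R := fine (mu `]a, b]%classic).

Let m_fin a b : mu `]a, b]%classic \is a fin_num.
Proof.
have [_ radon _] := muP; rewrite ge0_fin_numE //.
have /(le_lt_trans _) := radon `[a, b]%classic (@segment_compact _ _ _).
apply; apply: le_measure; rewrite ?inE; try exact: measurable_itv.
by apply: subset_itv; rewrite bnd_simp.
Qed.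

Let m_ge0 a b : 0 <= m a b. Proof. exact: fine_ge0. Qed.

Let m_add a b c : a <= b -> b <= c -> m a c = m a b + m b c.
Proof.
move=> ab bc; rewrite /m -fineD //; congr fine.
rewrite -measureU //.
- congr (mu _); apply/seteqP; split=> x /=; rewrite !in_itv /=.
    by move=> /andP[-> ->]; rewrite andbT /=; case: leP => _; [left|right].
  move=> [|] /andP[ax xc]; first by rewrite ax (le_trans xc).
  by rewrite xc (le_lt_trans ab ax).
- apply/seteqP; split=> x //= []; rewrite !in_itv /= => /andP[_ xb] /andP[bx _].
  by move: bx; rewrite ltNge xb.
Qed.

Let Phi (x : R) : R := if 0 <= x then m 0 x else - m x 0.

Let PhiB a b : a <= b -> Phi b - Phi a = m a b.
Proof.
move=> ab; rewrite /Phi; case: (leP 0 a) => a0.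
  by rewrite (le_trans a0 ab) (m_add a0 ab) addrC addKr.
case: (leP 0 b) => b0; first by rewrite opprK addrC -(m_add (ltW a0) b0).
by rewrite (m_add ab (ltW b0)) opprK addrC addrK.
Qed.

Let mJ (g : T) : exists2 c, 0 < c &
  forall a b, m (act g a) (act g b) = c * m a b.
Proof.
have [_ _ /(_ (val g) (valP g))[c c0 muJ]] := muP.
exists c^-1; first by rewrite invr_gt0.
move=> a b; apply: (mulfI (lt0r_neq0 c0)); rewrite mulVKf ?gt_eqF //.
rewrite /m -[in RHS](_ : act g @^-1` `]act g a, act g b]%classic = `]a, b]%classic);
  last first.
  by apply/seteqP; split=> x /=; rewrite !in_itv /= act_lt act_le.
have := muJ `]act g a, act g b]%classic (measurable_itv _).
by rewrite /pushforward /= => ->; rewrite fineM.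
Qed.

(** [Phi] is the distribution function of [mu]; its increments are the measures of
    intervals, which [g] rescales by a constant. *)
Lemma measure_affine_equivariant : exists Phi, affine_equivariant G Phi.
Proof.
exists Phi; split.
- by move=> x y xy; rewrite -subr_ge0 PhiB.
- apply: contrapT => ctPhi.
  have m0 n : mu `](- n%:R : R), n%:R]%classic = 0%E.
    have nn : - n%:R <= n%:R :> R by rewrite ge0_cp.
    rewrite -(fineK (m_fin _ _)); congr EFin.
    rewrite -[fine _]/(m _ _) -PhiB //.
    apply/eqP; rewrite subr_eq0 eq_le; apply/andP; split.
      by rewrite leNgt; apply/negP => lt; apply: ctPhi; exists (- n%:R), n%:R.
    by rewrite -subr_ge0 PhiB.
  have muT : mu setT = 0%E.
    have -> : setT = \bigcup_n `](- n%:R : R), n%:R]%classic.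
      apply/esym/seteqP; split=> // x _; exists (Num.truncn `|x|).+1 => //=.
      have : `|x| < (Num.truncn `|x|).+1%:R by rewrite -truncn_lt_nat.
      by rewrite in_itv /= ltr_norml => /andP[-> /ltW].
    apply: measure_negligible; first exact: bigcupT_measurable.
    apply: negligible_bigcup => n.
    by apply/negligibleP; [exact: measurable_itv | exact: m0].
  have [[B mB muB] _ _] := muP; apply: muB.
  apply/eqP; rewrite eq_le measure_ge0 andbT -muT.
  by apply: le_measure => //; rewrite inE.
- move=> g; have [c c0 gE] := mJ g; exists c, (Phi (act g 0) - c * Phi 0).
  split=> // x; have [x0|/ltW x0] := leP 0 x.
    have := PhiB (a := act g 0) (b := act g x).
    rewrite act_le gE -PhiB // => /(_ x0); lra.
  have := PhiB (a := act g x) (b := act g 0).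
  rewrite act_le gE -PhiB // => /(_ x0); lra.
Qed.

End DistributionFunction.

(** * Common fixed points of normal subgroups *)

Section CommonFixedPoints.
Variables (R : realType) (G : groupClosed (homeo_plus R)).
Local Notation T := (subgroup G).
Implicit Types (a g h k : T) (x y z : R) (S E F : set R) (K : set T).

Definition is_normal K := is_subgroup K /\ forall k g, K k -> K (k ^ g)%g.

Definition fixes K x := forall k, K k -> act k x = x.

(** If [K] has no common fixed point in [F], then the orbits of [K] in [F] and the
    fixed set in [F] of each element of [K] are unbounded, and some [k] in [K]
    moves a point [x] of [F] beyond [a x].  Let [p < x < q] be the fixed points of
    [k] in [F] nearest to [x]; then [p < a p < q].  The conjugate [k' = a k a^-1]
    permutes the fixed points of [k] in [F] and fixes [a p], so that [k' q] and
    [k'^-1 q] are above [p] and hence at least [q].  Thus [k'] fixes [q], that is,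
    [k] fixes [a^-1 q].  This fixed point is below [q] and hence at most [p], which
    contradicts [a p < q]. *)
Lemma commuting_common_fixed_point F K a : up a ->
    closed F -> F !=set0 -> invariant_set G F -> is_normal K ->
    (forall k h x, K k -> K h -> F x -> act k (act h x) = act h (act k x)) ->
    (forall k, K k -> exists x, act k x = x) ->
  exists2 x, F x & fixes K x.
Proof.
move=> ua cF F0 iF [/is_subgroupP[K1 KM KV] KJ] comm fixpt.
apply: contrapT => nofix.
have Finv g y : F y -> F (act g y) := invariant_setP g iF.
have unbounded S : S `<=` F -> S !=set0 ->
    (forall k y, K k -> S y -> S (act k y)) ->
    ~ has_ubound S /\ ~ has_lbound S.
  move=> SF S0 Sinv; have clSF : closure S `<=` F.
    by move/closure_id : cF => ->; exact: closure_subset.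
  split=> bS; apply: nofix.
    exists (sup S); first by apply: clSF; exact: closure_sup.
    by move=> k Kk; apply: sup_fixed => // y; apply: Sinv => //; exact: KV.
  exists (inf S); first by apply: clSF; exact: closure_inf.
  by move=> k Kk; apply: inf_fixed => // y; apply: Sinv => //; exact: KV.
have [x Fx] := F0.
have [k Kk axk] : exists2 k, K k & act a x < act k x.
  apply: contrapT => bnd.
  have [|||+ _] := unbounded [set act k x | k in K].
  - by move=> _ [h _ <-]; exact: Finv.
  - by exists x, 1%g.
  - by move=> g _ Kg [h Kh <-]; exists (g * h)%g; [exact: KM | exact: actM].
  - apply; exists (act a x) => _ [h Kh <-]; rewrite leNgt; apply/negP => lt.
    by apply: bnd; exists h.
pose Fk := F `&` [set y | act k y = y].
have cFk : closed Fk by apply: closedI => //; exact: closed_fixed_points.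
have Fkinv h y : K h -> Fk y -> Fk (act h y).
  by move=> Kh [Fy ky]; split; [exact: Finv | rewrite /= comm // ky].
have [p0 kp0] := fixpt k Kk.
have Fk0 : Fk !=set0.
  have [||s Fs ks] := fixed_point_in_closed cF F0 _ _ kp0; last by exists s.
  - exact: Finv.
  - exact: Finv.
have [nub nlb] := unbounded Fk (@subIsetl _ _ _) Fk0 Fkinv.
pose L := Fk `&` [set y | y <= x].
pose U := Fk `&` [set y | x <= y].
have Lub : has_ubound L by exists x => y [].
have Ulb : has_lbound U by exists x => y [].
have L0 : L !=set0.
  apply: contrapT => L0; apply: nlb; exists x => y Fky.
  rewrite leNgt; apply/negP => yx.
  by apply: L0; exists y; split => //; exact: ltW.
have U0 : U !=set0.
  apply: contrapT => U0; apply: nub; exists x => y Fky.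
  rewrite leNgt; apply/negP => xy.
  by apply: U0; exists y; split => //; exact: ltW.
set p := sup L; set q := inf U.
have [[Fp /= kp] /= px] : L p.
  by apply: closed_sup => //; apply: closedI => //; exact: closed_le.
have [[Fq /= kq] /= xq] : U q.
  by apply: closed_inf => //; apply: closedI => //; exact: closed_ge.
have gap y : Fk y -> p < y -> q <= y.
  move=> Fky py; have [yx|/ltW xy] := leP y x; last by apply: ge_inf.
  have : y <= p by exact: ub_le_sup.
  by rewrite leNgt py.
have xk : x < act k x := lt_trans (ua x) axk.
have p_lt_x : p < x.
  by rewrite lt_neqAle px andbT; apply/eqP => pE; move: xk; rewrite -pE kp ltxx.
have x_lt_q : x < q.
  rewrite lt_neqAle xq andbT; apply/eqP => qE.
  by move: xk; rewrite [x in act k x]qE kq qE ltxx.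
have axq : act a x < q by rewrite -kq; apply: lt_trans axk _; rewrite act_lt.
have apq : act a p < q by apply: lt_trans axq; rewrite act_lt.
pose k' := (k ^ a^-1)%g.
have Kk' : K k' by exact: KJ.
have k'a y : act k' (act a y) = act a (act k y).
  by rewrite /k' conjgE invgK !actM actK.
have k'ap : act k' (act a p) = act a p by rewrite k'a kp.
have Fkq : Fk q by [].
have k'q : act k' q = q.
  apply/eqP; rewrite eq_le -actV_le; apply/andP; split.
    apply: gap; first by apply: Fkinv => //; exact: KV.
    by rewrite actV_lt; apply: lt_trans apq; rewrite -[ltRHS]k'ap act_lt; exact: ua.
  apply: gap; first exact: Fkinv.
  by apply: lt_trans (ua p) _; rewrite -k'ap act_lt.
have Fkr : Fk (act a^-1%g q).
  split; first exact: Finv.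
  by apply: (@act_inj _ _ a); rewrite -k'a actVK.
have [pr|] := ltP p (act a^-1%g q).
  by have := gap _ Fkr pr; rewrite actV_le leNgt ua.
by rewrite le_actV leNgt apq.
Qed.

Lemma is_normal_derived n : is_normal (derived_series T n).
Proof. by split; [exact: derived_group | exact: derived_conj]. Qed.

(** The common fixed points of a normal subgroup form a closed invariant set, so
    that [E] is contained in it as soon as it meets it. *)
Lemma minimal_normal_fixes E K x : minimal_set G E -> is_normal K ->
  E x -> fixes K x -> E `<=` fixes K.
Proof.
move=> mE [_ KJ] Ex fx.
apply: (minimal_absorbs mE); last by exists x.
- have -> : fixes K = \bigcap_(k in K) [set y | act k y = y] by [].
  by apply: closed_bigI => k _; exact: closed_fixed_points.
- apply/invariantP => g y fy k Kk.
  have := fy _ (KJ _ g Kk); rewrite conjgE !actM => {2}<-.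
  by rewrite actVK.
Qed.

End CommonFixedPoints.

(** * A normal subgroup acting freely on a minimal set *)

Section FreeNormalSubgroup.
Variables (R : realType) (G : groupClosed (homeo_plus R)).
Local Notation T := (subgroup G).
Implicit Types (a b c g h k : T) (x y z : R) (S E F : set R) (K : set T).

Definition trivial_on E k := forall x, E x -> act k x = x.

Record free_commuting E K : Prop := FreeCommuting {
  fc_normal : is_normal K;
  fc_comm : forall k h x, K k -> K h -> E x -> act k (act h x) = act h (act k x);
  fc_free : forall k, K k -> (exists x, act k x = x) -> trivial_on E k
}.

Lemma free_trichotomy E K k : free_commuting E K -> K k ->
  [\/ trivial_on E k, up k | up k^-1%g].
Proof.
move=> fcK Kk; have [fx|/up_or_down[]] := pselect (exists x, act k x = x).
- by constructor 1; exact: (fc_free fcK Kk fx).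
- by constructor 2.
- by constructor 3.
Qed.

Lemma trivial_on_group E : is_subgroup (trivial_on E).
Proof.
apply/is_subgroupP; split=> // [k h tk th x Ex|k tk x Ex].
  by rewrite actM th ?tk.
exact/act_fixV/tk.
Qed.

(** When [k] and [h] commute on [E], [h] preserves the set of fixed points of [k]
    in [E]; if [h] has a fixed point at all, it has one in this set, which is then
    fixed by the product. *)
Lemma fixed_point_elements_normal E K : closed E -> E !=set0 ->
    invariant_set G E -> is_normal K ->
    (forall k h x, K k -> K h -> E x -> act k (act h x) = act h (act k x)) ->
  is_normal [set k | K k /\ exists x, act k x = x].
Proof.
move=> cE E0 iE [sK KJ] comm; have /is_subgroupP[K1 KM KV] := sK.
have Einv g y : E y -> E (act g y) := invariant_setP g iE.
split.
  apply/is_subgroupP; split=> [|k h [Kk [p kp]] [Kh [q hq]]|k [Kk [p kp]]].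
  - by split=> //; exists 0.
  - split; first exact: KM.
    have [s [Es ks] hs] : exists2 s, (E `&` [set x | act k x = x]) s & act h s = s.
      apply: (fixed_point_in_closed _ _ _ _ hq).
      + by apply: closedI => //; exact: closed_fixed_points.
      + have [||s Es ks] := fixed_point_in_closed cE E0 _ _ kp; last by exists s.
          exact: Einv.
        exact: Einv.
      + by move=> x [Ex kx]; split; [exact: Einv | rewrite /= comm // kx].
      + move=> x [Ex kx]; split; first exact: Einv.
        by rewrite /= comm ?kx //; exact: KV.
    by exists s; rewrite actM hs.
  - by split; [exact: KV | exists p; exact: act_fixV].
move=> k g [Kk [p kp]]; split; first exact: KJ.
by exists (act g^-1%g p); rewrite conjgE !actM actVK kp.
Qed.

(** The last derived subgroup acting nontrivially on [E] commutes on [E].  Its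
    elements with fixed points form a normal subgroup, which has a common fixed
    point in [E] and is therefore trivial on [E]. *)
Lemma solvable_free_commuting E a : minimal_set G E -> up a -> solvable_group T ->
  exists n, [/\ free_commuting E (derived_series T n),
    derived_series T n.+1 `<=` trivial_on E
    & exists2 b, derived_series T n b & up b].
Proof.
move=> mE ua [N DN]; have [[e Ee] cE iE _] := mE.
pose P n := `[< derived_series T n `<=` trivial_on E >].
have PN : exists n, P n.
  by exists N; apply/asboolP; rewrite /solvable_of_length_le in DN; rewrite DN => _ ->.
case: (ex_minnP PN) => -[|n] /asboolP Dtriv minP.
  by have := ua e; rewrite (Dtriv a I e Ee) ltxx.
have ntriv : ~ derived_series T n `<=` trivial_on E.
  by move=> tr; have := minP n; rewrite ltnn => /(_ (asboolT tr)).
have comm k h x : derived_series T n k -> derived_series T n h -> E x ->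
    act k (act h x) = act h (act k x).
  by move=> Dk Dh Ex; rewrite act_commg (Dtriv [~ k, h]%g) //; exact: derived_comm.
have nD := is_normal_derived G n.
have nB : is_normal [set k | derived_series T n k /\ exists x, act k x = x].
  by apply: fixed_point_elements_normal nD comm => //; exists e.
have [x Ex fx] := commuting_common_fixed_point ua cE (ex_intro _ e Ee) iE nB
  (fun k h x Kk Kh => comm k h x Kk.1 Kh.1) (fun k Kk => Kk.2).
have Bfix := minimal_normal_fixes mE nB Ex fx.
have fcD : free_commuting E (derived_series T n).
  by split=> // k Dk fk y Ey; exact: Bfix.
exists n; split=> //; apply: contrapT => nup; apply: ntriv => k Dk.
have [//|uk|uk] := free_trichotomy fcD Dk; case: nup; first by exists k.
by have /is_subgroupP[_ _ DV] := derived_group T n; exists k^-1%g => //; exact: DV.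
Qed.

Definition central_on E c := forall g x, E x -> act g (act c x) = act c (act g x).

Lemma central_on_group E : invariant_set G E -> is_subgroup (central_on E).
Proof.
move=> iE; have Einv g y : E y -> E (act g y) := invariant_setP g iE.
apply/is_subgroupP; split=> // [b c cb cc g x Ex|c cc g x Ex].
  by rewrite !actM cb ?cc //; exact: Einv.
apply: (@act_inj _ _ c); rewrite -cc; last exact: Einv.
by rewrite !actVK.
Qed.

(** Let [z = [~ h, k]] be central on [E] and let [w] be the power of [z] such that
    [w x0 <= h x0 < z w x0].  On [E] this bounds [h y] strictly by [w z ^ 2 y], as
    one sees by locating [y] between consecutive powers of [z] applied to [x0].
    But [h k ^ 2 = z ^ 2 k ^ 2 h], so that [h y >= w z ^ 2 y] for [y = k ^ 2 x0]. *)
Lemma up_central_not_commutator E h k : E !=set0 -> invariant_set G E ->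
  up [~ h, k]%g -> ~ central_on E [~ h, k]%g.
Proof.
move=> [x0 Ex0] iE; set z := [~ h, k]%g => uz cz.
have Einv g y : E y -> E (act g y) := invariant_setP g iE.
have cenz m : central_on E (zpow z m).
  by apply: (zpow_closed (K := central_on E)) => //; exact: central_on_group.
have hkE y : E y -> act h (act k y) = act z (act k (act h y)).
  by move=> Ey; rewrite act_commg -/z cz // cz //; exact: Einv.
have [m /andP[wh hw]] := up_floor x0 (act h x0) uz.
have [i /andP[uy yu]] := up_floor x0 (act k (act k x0)) uz.
set w := zpow z m in wh; set u := zpow z i in uy.
set y := act k (act k x0) in uy yu.
have hy : act h y = act z (act z (act k (act k (act h x0)))).
  rewrite /y hkE; last exact: Einv.
  by rewrite hkE // [act k (act z _)]cz //; exact/Einv/Einv.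
have lower : act w (act z (act z y)) <= act h y.
  have Ey : E y by exact/Einv/Einv.
  rewrite hy -(cenz m) ?act_le; last exact: Einv.
  rewrite -(cenz m) // act_le /y -(cenz m); last exact: Einv.
  by rewrite -(cenz m) // !act_le.
have upper : act h y < act w (act z (act z y)).
  apply: (@lt_le_trans _ _ (act h (act (zpow z (i + 1)) x0))); first by rewrite act_lt.
  rewrite (cenz (i + 1)) //.
  apply: (@le_trans _ _ (act (zpow z (i + 1)) (act (zpow z (m + 1)) x0))).
    by rewrite act_le ltW.
  have -> : act (zpow z (i + 1)) (act (zpow z (m + 1)) x0) =
      act w (act z (act z (act u x0))).
    rewrite -[act z (act u x0)]actM -zpowS -[act z (act _ x0)]actM -zpowS.
    by rewrite -!actM -!zpowD; congr (act (zpow z _) x0); ring.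
  by rewrite !act_le.
by move: (lt_le_trans upper lower); rewrite ltxx.
Qed.

(** A least positive element [b] of [derived_series T n.+1] would generate it on
    [E] and would be fixed by conjugation.  The commutators that generate this subgroup
    would then be central, and therefore trivial on [E]. *)
Lemma derived_no_least_positive E n x0 b : minimal_set G E -> E x0 ->
    free_commuting E (derived_series T n.+1) ->
    derived_series T n.+1 b -> up b ->
  exists c, [/\ derived_series T n.+1 c, up c & act c x0 < act b x0].
Proof.
move=> mE Ex0 fcD Db ub; apply: contrapT => least.
have {}least c : derived_series T n.+1 c -> up c -> act b x0 <= act c x0.
  by move=> Dc uc; rewrite leNgt; apply/negP => lt; apply: least; exists c.
have [_ _ iE _] := mE.
have Einv g y : E y -> E (act g y) := invariant_setP g iE.
have sD := derived_group T n.+1; have /is_subgroupP[_ DM DV] := sD.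
have least_on_E c y : derived_series T n.+1 c -> up c -> E y -> act b y <= act c y.
  move=> Dc uc Ey.
  have Dbc : derived_series T n.+1 (b^-1 * c)%g by apply: DM => //; exact: DV.
  have [tr|ubc|] := free_trichotomy fcD Dbc.
  - by have := tr y Ey; rewrite actM => /(congr1 (act b)); rewrite actVK => ->.
  - by have := ubc y; rewrite actM actV_lt => /ltW.
  - move=> /(_ x0); rewrite invgM invgK actM actV_lt => lt.
    by have := least c Dc uc; rewrite leNgt lt.
have cen_b : central_on E b.
  have conj_b g y : E y -> act b (act g y) <= act g (act b y).
    move=> Ey; have -> : act g (act b y) = act (b ^ g^-1)%g (act g y).
      by rewrite conjgE invgK !actM actK.
    apply: least_on_E; [exact: derived_conj | | exact: Einv].
    by move=> x; rewrite conjgE invgK !actM -lt_actV.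
  move=> g y Ey; apply/eqP; rewrite eq_le conj_b // andbT.
  have := conj_b g^-1%g (act g y) (Einv _ _ Ey).
  by rewrite actK -(act_le g) actVK.
have cenM := (is_subgroupP _).1 (central_on_group iE).
have up_cen c : derived_series T n.+1 c -> up c -> central_on E c.
  move=> Dc uc; have [m /andP[mc cm]] := up_floor x0 (act c x0) ub.
  have Db' : derived_series T n.+1 (zpow b m) by exact: (zpow_closed m sD Db).
  have De : derived_series T n.+1 ((zpow b m)^-1 * c)%g.
    by apply: DM => //; exact: DV.
  have tr : trivial_on E ((zpow b m)^-1 * c)%g.
    have [//|ue|/(_ x0)] := free_trichotomy fcD De.
      by have := least _ De ue; rewrite leNgt actM lt_actV -actM -zpowSr cm.
    by rewrite invgM invgK actM actV_lt ltNge mc.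
  have cE y : E y -> act c y = act (zpow b m) y.
    move=> Ey; have := tr y Ey; rewrite actM => /(congr1 (act (zpow b m))).
    by rewrite actVK.
  move=> g y Ey; rewrite !cE //; last exact: Einv.
  by apply: (zpow_closed (K := central_on E)) => //; exact: central_on_group.
have triv : derived_series T n.+1 `<=` trivial_on E.
  apply: derived_min; first exact: trivial_on_group.
  move=> h k Dh Dk; have Dz := derived_comm Dh Dk.
  have [//|uz|] := free_trichotomy fcD Dz.
    by case: (up_central_not_commutator (ex_intro _ x0 Ex0) iE uz); exact: up_cen.
  rewrite invgR => uz.
  case: (up_central_not_commutator (ex_intro _ x0 Ex0) iE uz).
  by apply: up_cen => //; exact: derived_comm.
by have := ub x0; rewrite (triv b) ?ltxx.
Qed.

End FreeNormalSubgroup.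

(** * Translation numbers *)

Lemma small_eq0 (R : realType) (C x : R) :
  (forall e, 0 < e -> `|x| <= C * e) -> x = 0.
Proof.
move=> small; apply/eqP; rewrite -normr_eq0; apply/negPn/negP => x0.
have {x0} xpos : 0 < `|x| by rewrite lt_neqAle eq_sym x0 normr_ge0.
have C0 : 0 < C.
  by have := small 1 ltr01; rewrite mulr1; exact: lt_le_trans.
have := small (`|x| / (2 * C)) (divr_gt0 xpos (mulr_gt0 (ltr0Sn _ 1) C0)).
have -> : C * (`|x| / (2 * C)) = `|x| / 2 by field; rewrite gt_eqF.
lra.
Qed.

Section TranslationNumber.
Variables (R : realType) (G : groupClosed (homeo_plus R)).
Local Notation T := (subgroup G).
Implicit Types (b c d g : T) (x y z : R) (m : int).
Variables (E : set R) (K : set T) (x0 : R) (a : T).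
Hypotheses (Ex0 : E x0) (iE : invariant_set G E) (fcK : free_commuting E K).
Hypotheses (Ka : K a) (ua : up a).

Let Einv g y : E y -> E (act g y). Proof. exact: invariant_setP. Qed.

Let sK : is_subgroup K. Proof. by have [[]] := fcK. Qed.
Let KM b c : K b -> K c -> K (b * c)%g.
Proof. by have /is_subgroupP[_ + _] := sK; apply. Qed.
Let KV b : K b -> K b^-1%g.
Proof. by have /is_subgroupP[_ _] := sK; apply. Qed.
Let KX b (n : nat) : K b -> K (b ^+ n)%g.
Proof. by move=> Kb; exact: (zpow_closed n sK Kb). Qed.
Let KA m : K (zpow a m). Proof. exact: zpow_closed. Qed.
Let KJ b g : K b -> K (b ^ g)%g. Proof. by have [[_ +] _ _] := fcK; apply. Qed.

Definition below b c := act b x0 <= act c x0.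

(** An element of [K] that is not trivial on [E] moves all points in the same
    direction, here applied to [b^-1 c]. *)
Lemma below_on_E b c y : K b -> K c -> below b c -> E y -> act b y <= act c y.
Proof.
move=> Kb Kc bc Ey; have [tr|ud|] := free_trichotomy fcK (KM (KV Kb) Kc).
- by have := tr y Ey; rewrite actM => /(congr1 (act b)); rewrite actVK => ->.
- by have := ud y; rewrite actM actV_lt => /ltW.
- move=> /(_ x0); rewrite invgM invgK actM actV_lt => lt.
  by move: bc; rewrite /below leNgt lt.
Qed.

Lemma belowM b b' c c' : K b -> K b' -> below b b' -> below c c' ->
  below (b * c)%g (b' * c')%g.
Proof.
move=> Kb Kb' bb cc; rewrite /below !actM.
apply: (@le_trans _ _ (act b (act c' x0))); first by rewrite act_le.
by apply: below_on_E => //; exact: Einv.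
Qed.

Lemma belowX b c n : K b -> K c -> below b c -> below (b ^+ n)%g (c ^+ n)%g.
Proof.
move=> Kb Kc bc; elim: n => [|n IH]; first exact: lexx.
by rewrite !expgS; exact: belowM.
Qed.

Lemma expgMn_on_E b c n y : K b -> K c -> E y ->
  act ((b * c) ^+ n)%g y = act (b ^+ n * c ^+ n)%g y.
Proof.
move=> Kb Kc Ey; elim: n => [|n IH] //.
rewrite !expgS actM IH !actM (fc_comm fcK Kc (KX n Kb)) //.
exact: Einv.
Qed.

Lemma zpow_below m n : below (zpow a m) (zpow a n) -> m <= n.
Proof.
by rewrite /below leNgt [m <= n]leNgt; apply: contraNN => /(zpow_lt x0 ua).
Qed.

(** A Dedekind cut, whose supremum is the translation number of [b] relative to
    that of [a], as in the embedding of archimedean ordered groups into the reals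
    due to Hoelder. *)
Definition tau_cut b : set R :=
  [set r | exists (m : int) (n : nat),
     below (zpow a m) (b ^+ n.+1)%g /\ r = m%:~R / n.+1%:R].

Definition tau b : R := sup (tau_cut b).

Lemma tau_cut_nonempty b : tau_cut b !=set0.
Proof.
have [m /andP[mb _]] := up_floor x0 (act b x0) ua.
by exists (m%:~R / 1%:R), m, 0%N.
Qed.

Lemma tau_cut_le b r (m : int) n : K b -> tau_cut b r ->
  below (b ^+ n.+1)%g (zpow a m) -> r <= m%:~R / n.+1%:R.
Proof.
move=> Kb [p [k [pb ->]]] bm.
rewrite ler_pdivrMr // mulrAC ler_pdivlMr // !pmulrn -!intrM ler_int.
apply: zpow_below; rewrite !zpowM.
apply: (@le_trans _ _ (act ((b ^+ k.+1) ^+ n.+1)%g x0)).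
  by apply: belowX => //; exact: KX.
rewrite expgnAC; apply: belowX => //; exact: KX.
Qed.

Lemma tau_cut_ub b : K b -> has_ubound (tau_cut b).
Proof.
move=> Kb; have [m /andP[_ bm]] := up_floor x0 (act b x0) ua.
exists ((m + 1)%:~R / 1%:R) => r br.
by apply: (@tau_cut_le b r (m + 1) 0) => //; exact: ltW.
Qed.

Lemma le_tau b (m : int) n : K b -> below (zpow a m) (b ^+ n.+1)%g ->
  m%:~R / n.+1%:R <= tau b.
Proof. by move=> Kb mb; apply: ub_le_sup; [exact: tau_cut_ub | exists m, n]. Qed.

Lemma tau_le b (m : int) n : K b -> below (b ^+ n.+1)%g (zpow a m) ->
  tau b <= m%:~R / n.+1%:R.
Proof.
move=> Kb bm; apply: ge_sup; first exact: tau_cut_nonempty.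
by move=> r br; exact: tau_cut_le bm.
Qed.

Lemma tau_homo b c : K b -> K c -> below b c -> tau b <= tau c.
Proof.
move=> Kb Kc bc; apply: ge_sup; first exact: tau_cut_nonempty.
move=> _ [m [n [mb ->]]]; apply: le_tau => //; apply: le_trans mb _.
exact: belowX.
Qed.

(** Truncating at denominator [n.+1] costs at most [1 / n.+1] for each factor. *)
Lemma tauM b c : K b -> K c -> tau (b * c)%g = tau b + tau c.
Proof.
move=> Kb Kc; apply/eqP; rewrite -subr_eq0; apply/eqP.
apply: (@small_eq0 _ 2) => e e0.
have [n ne] : exists n : nat, n.+1%:R^-1 <= e.
  exists (Num.truncn e^-1); rewrite -[leRHS]invrK lef_pV2 ?posrE ?invr_gt0 //.
  by apply/ltW; rewrite -truncn_lt_nat // invr_ge0 ltW.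
have [m /andP[mb bm]] := up_floor x0 (act (b ^+ n.+1)%g x0) ua.
have [p /andP[pc cp]] := up_floor x0 (act (c ^+ n.+1)%g x0) ua.
have lob := le_tau Kb mb; have upb := tau_le Kb (ltW bm).
have loc := le_tau Kc pc; have upc := tau_le Kc (ltW cp).
have lobc : (m + p)%:~R / n.+1%:R <= tau (b * c)%g.
  apply: le_tau; first exact: KM.
  rewrite /below expgMn_on_E // zpowD; apply: belowM => //; exact: KX.
have upbc : tau (b * c)%g <= (m + 1 + (p + 1))%:~R / n.+1%:R.
  apply: tau_le; first exact: KM.
  rewrite /below expgMn_on_E // zpowD.
  by apply: belowM => //; [exact: KX | exact: ltW | exact: ltW].
move: lob upb loc upc lobc upbc; rewrite !intrD !mulrDl mulr1z !mul1r.
move: (n.+1%:R^-1) ne => s se *; rewrite ler_norml; apply/andP; split; lra.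
Qed.

Lemma tau1 : tau 1%g = 0.
Proof.
have K1 : K 1%g by have /is_subgroupP[] := sK.
by have := tauM K1 K1; rewrite mulg1 => /eqP; rewrite -subr_eq subrr => /eqP.
Qed.

Lemma tauV b : K b -> tau b^-1%g = - tau b.
Proof.
move=> Kb; apply/eqP; rewrite -addr_eq0 -tauM ?mulVg ?tau1 //.
exact: KV.
Qed.

Lemma tauX b n : K b -> tau (b ^+ n)%g = n%:R * tau b.
Proof.
move=> Kb; elim: n => [|n IH]; first by rewrite tau1 mul0r.
by rewrite expgS tauM ?IH; [rewrite -[in RHS]natr1; ring | | exact: KX].
Qed.

Lemma tauZ b m : K b -> tau (zpow b m) = m%:~R * tau b.
Proof.
move=> Kb; case: m => n; first by rewrite tauX // -pmulrn.
by rewrite /= tauV ?tauX //; [rewrite NegzE mulrNz mulNr | exact: KX].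
Qed.

Lemma tau_gt0 b : K b -> up b -> 0 < tau b.
Proof.
move=> Kb ub; have [[|n] ab] := upX_unbounded x0 (act a x0) ub.
  by have := lt_trans ab (ua x0); rewrite ltxx.
by apply: lt_le_trans (le_tau (m := 1) Kb (ltW ab)); rewrite divr_gt0.
Qed.

(** Conjugation by [g] preserves the order of [K], hence all inequalities between
    [a ^ m] and [b ^ n].  This gives one inequality for each of [b] and [b^-1]. *)
Lemma tau_conj b g : K b -> tau (b ^ g)%g = tau (a ^ g)%g * tau b.
Proof.
set l := tau (a ^ g)%g.
have l0 : 0 < l.
  apply: tau_gt0; first exact: KJ.
  by move=> y; rewrite conjgE !actM actV_lt.
have half c : K c -> tau c * l <= tau (c ^ g)%g.
  move=> Kc; rewrite -ler_pdivlMr //; apply: ge_sup; first exact: tau_cut_nonempty.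
  move=> _ [m [n [mc ->]]]; rewrite ler_pdivlMr // mulrAC ler_pdivrMr //.
  rewrite -tauZ; last exact: KJ.
  rewrite [leRHS]mulrC -tauX; last exact: KJ.
  apply: tau_homo; [by apply: zpow_closed => //; exact: KJ | by apply/KX/KJ |].
  rewrite /below -zpowJ -conjXg !conjgE !actM act_le.
  by apply: below_on_E => //; [exact: KX | exact: Einv].
move=> Kb; apply/eqP; rewrite eq_le mulrC half // andbT.
have := half _ (KV Kb); rewrite conjVg !tauV //; last exact: KJ.
by rewrite mulNr lerN2.
Qed.

Hypothesis no_least_positive :
  forall b, K b -> up b -> exists c, [/\ K c, up c & act c x0 < act b x0].

(** If [c] is below [d], one of [c] and [c^-1 d] has at most half the translation
    number of [d]. *)
Lemma tau_small e : 0 < e -> exists d, [/\ K d, up d & tau d <= e].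
Proof.
have halving n : exists d, [/\ K d, up d & tau d <= tau a / 2 ^+ n].
  elim: n => [|n [d [Kd ud dn]]]; first by exists a; rewrite expr0 divr1.
  have half : tau a / 2 ^+ n.+1 = tau a / 2 ^+ n / 2.
    by rewrite exprSr invfM mulrA.
  have [c [Kc uc cd]] := no_least_positive Kd ud.
  have Kcd := KM (KV Kc) Kd.
  have ucd : up (c^-1 * d)%g.
    have [tr|//|/(_ x0)] := free_trichotomy fcK Kcd.
      have := tr x0 Ex0; rewrite actM => /(congr1 (act c)); rewrite actVK => dc.
      by move: cd; rewrite dc ltxx.
    by rewrite invgM invgK actM actV_lt ltNge ltW.
  have := tauM (KV Kc) Kd; rewrite tauV // => E1.
  have [cle|clt] := leP (tau c) (tau a / 2 ^+ n.+1); first by exists c.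
  exists (c^-1 * d)%g; split=> //; rewrite E1; lra.
move=> e0; have [d [Kd ud dn]] := halving (Num.truncn (tau a / e)).+1.
exists d; split=> //; apply: le_trans dn _.
have ta : 0 <= tau a := ltW (tau_gt0 Ka ua).
rewrite ler_pdivrMr ?exprn_gt0 // mulrC -ler_pdivrMr //.
have : tau a / e < (Num.truncn (tau a / e)).+1%:R.
  by rewrite -truncn_lt_nat // divr_ge0 // ltW.
move/ltW/le_trans; apply; rewrite -natrX ler_nat.
by apply: ltnW; exact: ltn_expl.
Qed.

(** * The equivariant map of a free normal subgroup *)

Definition tau_below x : set R := [set tau b | b in [set b | K b /\ act b x0 <= x]].

Definition orbit_map x : R := sup (tau_below x).

Lemma tau_below_nonempty x : tau_below x !=set0.
Proof.
have [m /andP[mx _]] := up_floor x0 x ua.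
by exists (tau (zpow a m)), (zpow a m).
Qed.

Lemma tau_below_ub x c : K c -> x <= act c x0 -> ubound (tau_below x) (tau c).
Proof.
by move=> Kc xc _ [b [Kb bx] <-]; apply: tau_homo => //; exact: le_trans bx xc.
Qed.

Lemma orbit_map_le x c : K c -> x <= act c x0 -> orbit_map x <= tau c.
Proof.
by move=> Kc xc; apply: ge_sup; [exact: tau_below_nonempty | exact: tau_below_ub].
Qed.

Lemma le_orbit_map x b : K b -> act b x0 <= x -> tau b <= orbit_map x.
Proof.
move=> Kb bx; apply: ub_le_sup; last by exists b.
have [m /andP[_ /ltW xm]] := up_floor x0 x ua.
by exists (tau (zpow a (m + 1))); exact: tau_below_ub.
Qed.

Lemma orbit_map_bracket d x : K d -> up d ->
  exists b, [/\ K b, act b x0 <= x & x <= act (b * d)%g x0].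
Proof.
move=> Kd ud; have [m /andP[mx xm]] := up_floor x0 x ud.
exists (zpow d m); split=> //; first exact: zpow_closed.
by rewrite -zpowSr; exact: ltW.
Qed.

(** Both sides of the equality are determined up to [tau d], where [d] is an
    arbitrarily small element of [K], by elements of [K] that bracket [x] and
    [g x0]. *)
Lemma orbit_map_equivariant g x :
  orbit_map (act g x) = tau (a ^ g^-1)%g * orbit_map x + orbit_map (act g x0).
Proof.
set l := tau (a ^ g^-1)%g.
have l0 : 0 < l.
  apply: tau_gt0; first exact: KJ.
  by move=> y; rewrite conjgE invgK !actM -lt_actV.
apply/eqP; rewrite -subr_eq0; apply/eqP; apply: (@small_eq0 _ (l + 1)) => e e0.
have [d [Kd ud de]] := tau_small e0.
have [b [Kb bx xb]] := orbit_map_bracket x Kd ud.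
have [c [Kc cx xc]] := orbit_map_bracket (act g x0) Kd ud.
have Kbd := KM Kb Kd; have Kcd := KM Kc Kd.
have lox := le_orbit_map Kb bx; have upx := orbit_map_le Kbd xb.
have log := le_orbit_map Kc cx; have upg := orbit_map_le Kcd xc.
have gconj h : act g (act h x0) = act (h ^ g^-1)%g (act g x0).
  by rewrite conjgE invgK !actM actK.
have lo : l * tau b + tau c <= orbit_map (act g x).
  rewrite -tau_conj // -tauM //; last exact: KJ.
  apply: le_orbit_map; first by apply: KM => //; exact: KJ.
  apply: (@le_trans _ _ (act g (act b x0))); last by rewrite act_le.
  by rewrite gconj actM act_le.
have hi : orbit_map (act g x) <= l * tau (b * d)%g + tau (c * d)%g.
  rewrite -tau_conj // -tauM //; last exact: KJ.
  apply: orbit_map_le; first by apply: KM => //; exact: KJ.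
  apply: (@le_trans _ _ (act g (act (b * d)%g x0))); first by rewrite act_le.
  by rewrite gconj [leRHS]actM act_le.
move: upx upg hi; rewrite !tauM // => upx upg hi.
have mlo := ler_wpM2l (ltW l0) lox.
have mhi := ler_wpM2l (ltW l0) upx.
have mde := ler_wpM2l (ltW l0) de.
rewrite ler_norml; apply/andP; split; lra.
Qed.

Lemma orbit_map_affine_equivariant : affine_equivariant G orbit_map.
Proof.
split.
- move=> x y xy; apply: ge_sup; first exact: tau_below_nonempty.
  by move=> _ [b [Kb bx] <-]; apply: le_orbit_map => //; exact: le_trans xy.
- exists x0, (act a x0).
  have K1 : K 1%g by have /is_subgroupP[] := sK.
  apply: (@le_lt_trans _ _ (tau 1%g)); first exact: orbit_map_le.
  by rewrite tau1; apply: lt_le_trans (tau_gt0 Ka ua) _; exact: le_orbit_map.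
- move=> g; exists (tau (a ^ g^-1)%g), (orbit_map (act g x0)); split.
    apply: tau_gt0; first exact: KJ.
    by move=> y; rewrite conjgE invgK !actM -lt_actV.
  exact: orbit_map_equivariant.
Qed.

End TranslationNumber.

(** * Metabelian quotients *)

Lemma solvable_free_metabelian (R : realType) (G : groupClosed (homeo_plus R))
    (a : subgroup G) :
  solvable_group (subgroup G) -> up a -> metabelian (quotient_group (H_group G)).
Proof.
move=> solG ua; have [E mE] := minimal_set_exists ua.
have [[x0 Ex0] cE iE _] := mE.
have [[|n] [fcD Dtriv [b Db ub]]] := solvable_free_commuting mE ua solG.
  (* The first derived subgroup is already trivial on [E]. *)
  apply: (fixed_closed_set_metabelian cE _ iE); [by exists x0 | by exists E |].
  by move=> h /derived_succ_sub; exact: Dtriv.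
apply: equivariant_metabelian.
apply: (orbit_map_affine_equivariant Ex0 iE fcD Db ub) => c Dc uc.
exact: derived_no_least_positive mE Ex0 fcD Dc uc.
Qed.

Theorem corollary2 (R : realType) (G : groupClosed (homeo_plus R)) :
  ((exists mu : {measure set (measurableTypeR R) -> \bar R},
      projectively_invariant G mu) ->
   metabelian (quotient_group (H_group G)))
  /\
  (solvable_group (subgroup G) ->
   (exists2 g : homeo_plus R, g \in G & freely_acting g) ->
   metabelian (quotient_group (H_group G))).
Proof.
split=> [[mu /measure_affine_equivariant[Phi PhiP]]|solG [g gG free_g]].
  exact: equivariant_metabelian PhiP.
pose a : subgroup G := exist _ g gG.
have [|ua|ua] := @up_or_down _ _ a.
- by move=> [x gx]; have : [set t : R | g t = t] x := gx; rewrite free_g.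
- exact: solvable_free_metabelian ua.
- exact: solvable_free_metabelian ua.
Qed.
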